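(* A real $x$ is $\emptyset'$-Kurtz random if and only if $x$ is finitely left-c.e. random.
   Context: Reals are elements of $[0,1]$, identified with elements of $2^\omega$ via binary expansion; $\mu$ is Lebesgue measure. A real $a$ is left-c.e. if there is a computable nondecreasing sequence of rationals converging to $a$. A finitely left-c.e. test is a sequence $\{V_n=\bigcup_{i}[a_i^n,b_i^n]\}_{n\in\omega}$ ($i$ ranging over $\omega$) such that $a_i^n$ and $b_i^n$ are left-c.e. reals uniformly in $i$ and $n$, $a_i^n\le b_i^n$, for each $n$ there are only finitely many $i$ such that $b_i^n\ne 0$, and $\mu(V_n)\le 2^{-n}$ for all $n$. A real passes the test if it is not in $\bigcap_n V_n$; a real is finitely left-c.e. random if it passes all finitely left-c.e. tests. A real is $\emptyset'$-Kurtz random if it is not in any $\Pi^0_1(\emptyset')$ class of measure zero. *)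

(* Defs.v *)
From Stdlib Require Cantor.
From mathcomp Require Import all_boot all_order all_algebra.
From mathcomp Require Import all_classical all_reals all_analysis.
Set Implicit Arguments.
Unset Strict Implicit.
Unset Printing Implicit Defensive.
Import Order.TTheory GRing.Theory Num.Theory.
Import numFieldNormedType.Exports.
Local Open Scope classical_set_scope.
Local Open Scope ring_scope.

(** * Oracle computability

    Partial recursive functions relative to an oracle, presented as unary
    functions on [nat] over Cantor's pairing [Cantor.to_nat]; the identity is
    [Pair Left Right] and functions of several arguments take nested pairs. *)

Definition pairn (m n : nat) : nat := Cantor.to_nat (m, n).

Inductive code : Type :=
  | Zero | Succ | Left | Right | Oracle
  | Pair of code & code
  | Comp of code & code
  | Prec of code & code
  | Rfind of code.

(** [eval A c n y] : the program [c] with oracle [A] halts on input [n] with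
    output [y].  [Prec f g] on <a, k> is primitive recursion on [k] with base
    [f a] and step [g <a, <i, previous value>>]; [Rfind f] on [a] is the least
    [y] with [f <a, y> = 0], all smaller searches having halted. *)
Fixpoint eval (A : set nat) (c : code) (n y : nat) {struct c} : Prop :=
  match c with
  | Zero => y = 0%N
  | Succ => y = n.+1
  | Left => y = (Cantor.of_nat n).1
  | Right => y = (Cantor.of_nat n).2
  | Oracle => (A n /\ y = 1%N) \/ (~ A n /\ y = 0%N)
  | Pair f g => exists u v, [/\ eval A f n u, eval A g n v & y = pairn u v]
  | Comp f g => exists2 u, eval A g n u & eval A f u y
  | Prec f g =>
      let a := (Cantor.of_nat n).1 in
      (fix prec (k z : nat) {struct k} : Prop :=
         if k is i.+1
         then exists2 r, prec i r & eval A g (pairn a (pairn i r)) z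
         else eval A f a z) (Cantor.of_nat n).2 y
  | Rfind f =>
      eval A f (pairn n y) 0%N /\
      forall i, (i < y)%N -> exists v, eval A f (pairn n i) v.+1
  end.

Definition halts (A : set nat) (c : code) (n : nat) : Prop :=
  exists y, eval A c n y.

(** A bijective Goedel numbering of programs. *)
Fixpoint code_index (c : code) : nat :=
  match c with
  | Zero => 0%N
  | Succ => 1%N
  | Left => 2%N
  | Right => 3%N
  | Oracle => 4%N
  | Pair f g => (4 * pairn (code_index f) (code_index g) + 5)%N
  | Comp f g => (4 * pairn (code_index f) (code_index g) + 6)%N
  | Prec f g => (4 * pairn (code_index f) (code_index g) + 7)%N
  | Rfind f => (4 * code_index f + 8)%N
  end.

Definition jump (A : set nat) : set nat :=
  [set e | exists2 c, code_index c = e & halts A c e].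

(** The halting problem, i.e. the jump of the empty oracle. *)
Definition zero_jump : set nat := jump set0.

Definition computable (f : nat -> nat) : Prop :=
  exists c, forall n, eval set0 c n (f n).

Definition ce_in (A W : set nat) : Prop :=
  exists c, W = [set n | halts A c n].

(** * Cantor space *)

(** Bijective base-2 numbering of finite binary strings. *)
Fixpoint strn (s : seq bool) : nat :=
  if s is b :: s' then (2 * strn s' + b + 1)%N else 0%N.

(** Complements of unions of cylinders over an [A]-c.e. set of strings. *)
Definition Pi01_class (A : set nat) (P : set (nat -> bool)) : Prop :=
  exists2 W : set nat, ce_in A W &
    P = [set X | forall k, ~ W (strn (mkseq X k))].

(** The real of [0, 1] with binary expansion [X]. *)
Definition binval (R : realType) (X : nat -> bool) : R :=
  limn (series (fun i => (X i)%:R / 2 ^+ i.+1 : R)).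

(** [A]-Kurtz randomness; the measure of a class in Cantor space is the
    Lebesgue measure of the corresponding subset of [0, 1]. *)
Definition Kurtz_random (R : realType) (A : set nat) (X : nat -> bool) : Prop :=
  forall P : set (nat -> bool), Pi01_class A P ->
    lebesgue_measure (@binval R @` P) = 0%E -> ~ P X.

(** * Finitely left-c.e. randomness *)

(** An effective numbering of the rationals: the code <<u, v>, d> stands for
    (u - v) / (d + 1). *)
Definition ratn (n : nat) : rat :=
  let p := (Cantor.of_nat n).1 in
  ((Cantor.of_nat p).1%:R - (Cantor.of_nat p).2%:R)
    / (Cantor.of_nat n).2.+1%:R.

Definition uniformly_left_ce (R : realType) (a : nat -> nat -> R) : Prop :=
  exists2 f : nat -> nat, computable f &
    forall n i, let q s := ratn (f (pairn n (pairn i s))) in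
      (forall s, q s <= q s.+1) /\ ratr (q s) @[s --> \oo] --> a n i.

Definition test_level (R : realType) (a b : nat -> nat -> R) (n : nat) : set R :=
  \bigcup_i [set` `[a n i, b n i]].

Definition finitely_left_ce_test (R : realType) (a b : nat -> nat -> R) : Prop :=
  [/\ uniformly_left_ce a, uniformly_left_ce b,
      forall n i, [/\ 0 <= a n i, a n i <= b n i & b n i <= 1],
      forall n, finite_set [set i | b n i != 0] &
      forall n, (lebesgue_measure (test_level a b n) <= (2 ^- n)%:E)%E].

Definition finitely_left_ce_random (R : realType) (x : R) : Prop :=
  forall a b : nat -> nat -> R, finitely_left_ce_test a b ->
    ~ (\bigcap_n test_level a b n) x.

(* Main.v *)
From mathcomp Require Import all_boot all_order all_algebra.
From mathcomp Require Import all_classical all_reals all_analysis.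
From mathcomp Require Import zify lra.
Require Import Defs.
Set Implicit Arguments.
Unset Strict Implicit.
Unset Printing Implicit Defensive.
Import Order.TTheory GRing.Theory Num.Theory.
Import numFieldNormedType.Exports.
Local Open Scope classical_set_scope.
Local Open Scope ring_scope.
Local Open Scope nat_scope.

(** The proof rests on two descriptions of the sets that are c.e. in the halting
    problem and on a way of moving intervals to the right.

    A set W is c.e. in the halting problem iff it is [sigma2], that is, iff
    there is a decidable Q with: n is in W iff some w has Q n w v for all v
    ([sigma2_ce], [ce_sigma2]).  From left to right, a computation is replaced
    by a finite certificate, a set of claims <e, n, y> (program e maps n to y)
    each of which follows in one step from other claims of the set ([evalP]).
    Certificates are decidable, except that a claim about the oracle must be
    true; for the halting problem a positive answer is confirmed by some stage,
    and a negative one survives all stages.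

    Suppose that the real of X lies in all levels V_n of a finitely left-c.e.
    test.  As almost all intervals of V_n are {0}, V_n is closed, and a
    cylinder [l, u] misses V_n iff some N, t witness that for all i either b_i
    stays below a fixed dyadic smaller than l, or i < N and stage t of a_i is
    already beyond u.  This is a [sigma2] condition on the cylinder, so the
    sequences whose real lies in all V_n form a null class that is Pi01 in the
    halting problem, and X is not Kurtz random ([test_null_class]).

    Conversely, let X lie in a null class P that is Pi01 in the halting problem,
    and write the complementary set of strings in [sigma2] form by Q.  A
    cylinder of depth K survives stage s when every w <= K is refuted before s as
    a witness that removes one of its prefixes from P.  The cylinders of
    depth K that ever survive have a total measure that tends to the measure of
    P as K grows ([null_few_survivors]), so for each n some depth has at most
    2^(K-n) of them.  The guess for such a depth at stage s is the least one
    that still looks right; since survivors only accumulate, guesses only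
    increase, and they converge.  The interval reserved for a cylinder of depth
    K sits at [0, 0] until K becomes the guess and the cylinder survives, is
    then the cylinder itself, and moves to [1, 1] once K is given up.  Hence
    its endpoints only move to the right: they are left-c.e., and in the limit
    only the survivors of the final depth have positive length
    ([null_class_covered]). *)

(** * Closure properties of computable functions *)

Arguments Cantor.of_nat : simpl never.
Arguments Cantor.to_nat : simpl never.
Arguments pairn : simpl never.

Definition pl (n : nat) : nat := (Cantor.of_nat n).1.
Definition pr (n : nat) : nat := (Cantor.of_nat n).2.
Arguments pl : simpl never.
Arguments pr : simpl never.

Lemma plE a b : pl (pairn a b) = a.
Proof. by rewrite /pl /pairn Cantor.cancel_of_to. Qed.

Lemma prE a b : pr (pairn a b) = b.
Proof. by rewrite /pr /pairn Cantor.cancel_of_to. Qed.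

Lemma pairnK n : pairn (pl n) (pr n) = n.
Proof.
by rewrite /pl /pr /pairn; case E: (Cantor.of_nat n) => [a b] /=;
  rewrite -E Cantor.cancel_to_of.
Qed.

Lemma leq_pairn a b : a <= pairn a b /\ b <= pairn a b.
Proof. by have := Cantor.to_nat_non_decreasing a b; rewrite /pairn; lia. Qed.

Lemma pairn_inj a b c d : pairn a b = pairn c d -> a = c /\ b = d.
Proof. by move=> /Cantor.to_nat_inj [-> ->]. Qed.

Lemma eval_Prec0 A f g a z :
  eval A (Prec f g) (pairn a 0) z <-> eval A f a z.
Proof. by rewrite /= -/(pl _) -/(pr _) plE prE. Qed.

Lemma eval_PrecS A f g a k z :
  eval A (Prec f g) (pairn a k.+1) z <->
  exists2 r, eval A (Prec f g) (pairn a k) r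
           & eval A g (pairn a (pairn k r)) z.
Proof. by rewrite /= -!/(pl _) -!/(pr _) !plE !prE. Qed.

Lemma eval_fun A c n y z : eval A c n y -> eval A c n z -> y = z.
Proof.
elim: c n y z => [||||| f IHf g IHg | f IHf g IHg | f IHf g IHg | f IHf] n y z.
- by move=> -> ->.
- by move=> -> ->.
- by move=> -> ->.
- by move=> -> ->.
- by move=> [[? ->]|[? ->]] [[? ->]|[? ->]].
- move=> [u [v [fu gv ->]]] [u' [v' [fu' gv' ->]]].
  by rewrite (IHf _ _ _ fu fu') (IHg _ _ _ gv gv').
- move=> [u gu fy] [u' gu' fz].
  by move: fz; rewrite -(IHg _ _ _ gu gu'); exact: IHf.
- rewrite -(pairnK n); elim: (pr n) y z => [|k IHk] y z.
    by rewrite !eval_Prec0; exact: IHf.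
  rewrite !eval_PrecS => -[r er gy] [r' er' gz].
  by move: gz; rewrite -(IHk _ _ er er'); exact: IHg.
- move=> [f0 fS] [f0' fS'].
  case: (ltngtP y z) => // [/fS'|/fS] [v ev].
    by have := IHf _ _ _ f0 ev.
  by have := IHf _ _ _ f0' ev.
Qed.

Definition cfun (A : set nat) (f : nat -> nat) : Prop :=
  exists c, forall n, eval A c n (f n).

Definition cpred (A : set nat) (p : nat -> bool) : Prop :=
  cfun A (fun n => nat_of_bool (p n)).

Section Closure.
Variable A : set nat.
Local Notation cfun := (cfun A).
Local Notation cpred := (cpred A).
Implicit Types (f g h : nat -> nat) (p q : nat -> bool).

Lemma cfun_ext f g : f =1 g -> cfun f -> cfun g.
Proof. by move=> fg [c cf]; exists c => n; rewrite -fg. Qed.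

Lemma cfun_comp f g : cfun f -> cfun g -> cfun (fun n => f (g n)).
Proof. by move=> [c cf] [d dg]; exists (Comp c d) => n /=; exists (g n). Qed.

Lemma cfun_pl f : cfun f -> cfun (fun n => pl (f n)).
Proof. by apply: cfun_comp; exists Left. Qed.

Lemma cfun_pr f : cfun f -> cfun (fun n => pr (f n)).
Proof. by apply: cfun_comp; exists Right. Qed.

Lemma cfun_pair f g : cfun f -> cfun g -> cfun (fun n => pairn (f n) (g n)).
Proof.
by move=> [c cf] [d dg]; exists (Pair c d) => n /=; exists (f n), (g n).
Qed.

Lemma cfun_id : cfun id.
Proof.
exists (Pair Left Right) => n /=; exists (pl n), (pr n).
by rewrite pairnK.
Qed.

Lemma cfun_S f : cfun f -> cfun (fun n => (f n).+1).
Proof. by apply: cfun_comp; exists Succ. Qed.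

Lemma cfun_const k : cfun (fun=> k).
Proof. by elim: k => [|k IH]; [exists Zero | exact: cfun_S]. Qed.

(** [F] takes its arguments from an environment, and is applied to arbitrary
    computable arguments: this is how the lemmas below treat variables that are
    bound by a recursion, a sum or a bounded quantifier. *)
Lemma cfun_uncurry2 (F : nat -> nat -> nat) f g :
  cfun (fun e => F (pl e) (pr e)) -> cfun f -> cfun g ->
  cfun (fun n => F (f n) (g n)).
Proof.
move=> cF cf cg; have := cfun_comp cF (cfun_pair cf cg).
by apply: cfun_ext => n; rewrite plE prE.
Qed.

Lemma cpred_uncurry2 (P : nat -> nat -> bool) f g :
  cpred (fun e => P (pl e) (pr e)) -> cfun f -> cfun g ->
  cpred (fun n => P (f n) (g n)).
Proof. exact: (@cfun_uncurry2 (fun a b => nat_of_bool (P a b))). Qed.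

Lemma cfun_uncurry3 (F : nat -> nat -> nat -> nat) f g h :
  cfun (fun e => F (pl (pl e)) (pr (pl e)) (pr e)) ->
  cfun f -> cfun g -> cfun h -> cfun (fun n => F (f n) (g n) (h n)).
Proof.
move=> cF cf cg ch; have := cfun_comp cF (cfun_pair (cfun_pair cf cg) ch).
by apply: cfun_ext => n; rewrite !(plE, prE).
Qed.

Lemma cpred_uncurry3 (P : nat -> nat -> nat -> bool) f g h :
  cpred (fun e => P (pl (pl e)) (pr (pl e)) (pr e)) ->
  cfun f -> cfun g -> cfun h -> cpred (fun n => P (f n) (g n) (h n)).
Proof. exact: (@cfun_uncurry3 (fun a b c => nat_of_bool (P a b c))). Qed.

(** Primitive recursion whose base and step depend on the ambient variable. *)
Lemma cfun_rec (b N : nat -> nat) (F : nat -> nat -> nat -> nat) :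
  cfun b -> cfun (fun e => F (pl e) (pl (pr e)) (pr (pr e))) -> cfun N ->
  cfun (fun n => nat_rect (fun=> nat) (b n) (F n) (N n)).
Proof.
move=> [cb eb] [cF eF].
apply: (cfun_uncurry2 (F := fun n => nat_rect (fun=> nat) (b n) (F n)))
  (cfun_id).
exists (Prec cb cF) => e; rewrite -{1}(pairnK e).
elim: (pr e) => [|k IHk]; first exact/eval_Prec0.
apply/eval_PrecS; exists (nat_rect (fun=> nat) (b (pl e)) (F (pl e)) k) => //.
have := eF (pairn (pl e)
  (pairn k (nat_rect (fun=> nat) (b (pl e)) (F (pl e)) k))).
by rewrite !(plE, prE).
Qed.

Lemma cfun_pred f : cfun f -> cfun (fun n => (f n).-1).
Proof.
move=> cf; apply: (@cfun_ext (fun n => nat_rect (fun=> nat) 0 (fun k _ => k) (f n))).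
  by move=> n; case: (f n).
apply: cfun_rec => //; first exact: cfun_const.
exact/cfun_pl/cfun_pr/cfun_id.
Qed.

Lemma cfun_add f g : cfun f -> cfun g -> cfun (fun n => f n + g n).
Proof.
move=> cf cg.
apply: (@cfun_ext (fun n => nat_rect (fun=> nat) (f n) (fun _ r => r.+1) (g n))).
  by move=> n; elim: (g n) => [|k /= ->]; rewrite ?addn0 ?addnS.
by apply: cfun_rec => //; exact/cfun_S/cfun_pr/cfun_pr/cfun_id.
Qed.

Lemma cfun_sub f g : cfun f -> cfun g -> cfun (fun n => f n - g n).
Proof.
move=> cf cg.
apply: (@cfun_ext (fun n => nat_rect (fun=> nat) (f n) (fun _ r => r.-1) (g n))).
  by move=> n; elim: (g n) => [|k /= ->]; rewrite ?subn0 ?subnS.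
by apply: cfun_rec => //; exact/cfun_pred/cfun_pr/cfun_pr/cfun_id.
Qed.

Lemma cfun_mul f g : cfun f -> cfun g -> cfun (fun n => f n * g n).
Proof.
move=> cf cg.
apply: (@cfun_ext (fun n => nat_rect (fun=> nat) 0 (fun _ r => r + f n) (g n))).
  by move=> n; elim: (g n) => [|k /= ->]; rewrite ?muln0 ?mulnSr.
apply: cfun_rec => //; first exact: cfun_const.
apply: cfun_add; first exact/cfun_pr/cfun_pr/cfun_id.
by apply: (cfun_comp cf); exact/cfun_pl/cfun_id.
Qed.

Lemma cfun_exp f g : cfun f -> cfun g -> cfun (fun n => f n ^ g n).
Proof.
move=> cf cg.
apply: (@cfun_ext (fun n => nat_rect (fun=> nat) 1 (fun _ r => r * f n) (g n))).
  by move=> n; elim: (g n) => [|k /= ->]; rewrite ?expnSr.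
apply: cfun_rec => //; first exact: cfun_const.
apply: cfun_mul; first exact/cfun_pr/cfun_pr/cfun_id.
by apply: (cfun_comp cf); exact/cfun_pl/cfun_id.
Qed.

Lemma cpred_neg p : cpred p -> cpred (fun n => ~~ p n).
Proof.
move=> cp; apply: (@cfun_ext (fun n => 1 - p n)); first by move=> n; case: (p n).
exact/cfun_sub/cp/cfun_const.
Qed.

Lemma cpred_and p q : cpred p -> cpred q -> cpred (fun n => p n && q n).
Proof.
move=> cp cq; apply: (@cfun_ext (fun n => p n * q n)); last exact: cfun_mul.
by move=> n; case: (p n); case: (q n).
Qed.

Lemma cpred_or p q : cpred p -> cpred q -> cpred (fun n => p n || q n).
Proof.
move=> cp cq; apply: (@cfun_ext (fun n => ~~ (~~ p n && ~~ q n))).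
  by move=> n; case: (p n); case: (q n).
exact/cpred_neg/cpred_and/cpred_neg/cq/cpred_neg.
Qed.

Lemma cpred_eq0 f : cfun f -> cpred (fun n => f n == 0).
Proof.
move=> cf; apply: (@cfun_ext (fun n => 1 - f n)); first by move=> n; case: (f n).
exact/cfun_sub/cf/cfun_const.
Qed.

Lemma cpred_le f g : cfun f -> cfun g -> cpred (fun n => f n <= g n).
Proof. by move=> cf cg; exact/cpred_eq0/cfun_sub. Qed.

Lemma cpred_eq f g : cfun f -> cfun g -> cpred (fun n => f n == g n).
Proof.
move=> cf cg; apply: (@cfun_ext (fun n => (f n <= g n) && (g n <= f n))).
  by move=> n; rewrite eqn_leq.
by apply: cpred_and; exact: cpred_le.
Qed.

Lemma cfun_if p f g : cpred p -> cfun f -> cfun g ->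
  cfun (fun n => if p n then f n else g n).
Proof.
move=> cp cf cg; apply: (@cfun_ext (fun n => p n * f n + ~~ p n * g n)).
  by move=> n; case: (p n) => /=; rewrite ?mul1n ?mul0n ?addn0.
by apply: cfun_add; apply: cfun_mul => //; exact: cpred_neg.
Qed.

Lemma iota_rcons k : iota 0 k.+1 = iota 0 k ++ [:: k].
Proof. by rewrite -addn1 iotaD. Qed.

Lemma cpred_if p q (r : nat -> bool) : cpred p -> cpred q -> cpred r ->
  cpred (fun n => if p n then q n else r n).
Proof.
move=> cp cq cr; apply: (cfun_ext _ (cfun_if cp cq cr)).
by move=> n; case: (p n).
Qed.

Lemma cfun_count (q : nat -> nat -> bool) f :
  cpred (fun e => q (pl e) (pr e)) -> cfun f ->
  cfun (fun n => count (q n) (iota 0 (f n))).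
Proof.
move=> cq cf.
apply: (@cfun_ext (fun n => nat_rect (fun=> nat) 0 (fun k r => r + q n k) (f n))).
  move=> n; elim: (f n) => [|k IHk] //.
  by rewrite iota_rcons count_cat -IHk /= addn0.
apply: cfun_rec => //; first exact: cfun_const.
apply: cfun_add; first exact/cfun_pr/cfun_pr/cfun_id.
apply: (cfun_uncurry2 (F := fun a b => nat_of_bool (q a b))) => //.
  exact/cfun_pl/cfun_id.
exact/cfun_pl/cfun_pr/cfun_id.
Qed.

Lemma cpred_has (q : nat -> nat -> bool) f :
  cpred (fun e => q (pl e) (pr e)) -> cfun f ->
  cpred (fun n => has (q n) (iota 0 (f n))).
Proof.
move=> cq cf; apply: (@cfun_ext (fun n => 0 < count (q n) (iota 0 (f n)))).
  by move=> n; rewrite has_count.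
by apply: cpred_le; [exact: cfun_const | exact: cfun_count].
Qed.

Lemma cpred_all (q : nat -> nat -> bool) f :
  cpred (fun e => q (pl e) (pr e)) -> cfun f ->
  cpred (fun n => all (q n) (iota 0 (f n))).
Proof.
move=> cq cf.
apply: (@cfun_ext (fun n => ~~ has (fun k => ~~ q n k) (iota 0 (f n)))).
  by move=> n; rewrite -all_predC; congr nat_of_bool; apply: eq_all => k /=;
    rewrite negbK.
by apply: cpred_neg; apply: cpred_has => //; exact: cpred_neg.
Qed.

(** The least solution below [f n], and [f n] itself without a solution; it is
    obtained by counting the initial segments that contain no solution. *)
Lemma cfun_find (q : nat -> nat -> bool) f :
  cpred (fun e => q (pl e) (pr e)) -> cfun f ->
  cfun (fun n => find (q n) (iota 0 (f n))).
Proof.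
move=> cq cf.
apply: (@cfun_ext (fun n =>
  count (fun k => ~~ has (q n) (iota 0 k.+1)) (iota 0 (f n)))).
  move=> n; elim: (f n) => [|k IHk] //.
  rewrite [in LHS]iota_rcons count_cat IHk {IHk}.
  have -> : count (fun k => ~~ has (q n) (iota 0 k.+1)) [:: k] =
            ~~ has (q n) (iota 0 k.+1) by rewrite /= addn0.
  rewrite !iota_rcons find_cat has_cat size_iota.
  have [//|hk] := boolP (has (q n) (iota 0 k)); first by rewrite addn0.
  by rewrite hasNfind// size_iota /=; case: (q n k).
apply: cfun_count => //; apply: cpred_neg.
apply: (@cpred_has (fun e => q (pl e))) => /=.
  apply: (cfun_uncurry2 (F := fun a b => nat_of_bool (q a b))) => //.
    exact/cfun_pl/cfun_pl/cfun_id.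
  exact/cfun_pr/cfun_id.
exact/cfun_S/cfun_pr/cfun_id.
Qed.

Lemma cfun_sum (F : nat -> nat -> nat) f :
  cfun (fun e => F (pl e) (pr e)) -> cfun f ->
  cfun (fun n => \sum_(i < f n) F n i).
Proof.
move=> cF cf.
apply: (@cfun_ext (fun n => nat_rect (fun=> nat) 0 (fun k r => r + F n k) (f n))).
  by move=> n; elim: (f n) => [|k /= ->]; rewrite ?big_ord0 ?big_ord_recr.
apply: cfun_rec => //; first exact: cfun_const.
apply: cfun_add; first exact/cfun_pr/cfun_pr/cfun_id.
apply: cfun_uncurry2 => //; first exact/cfun_pl/cfun_id.
exact/cfun_pl/cfun_pr/cfun_id.
Qed.

(** The quotient counts the positive multiples of the divisor up to the
    dividend. *)
Lemma cfun_div f g : cfun f -> cfun g -> cfun (fun n => f n %/ g n).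
Proof.
move=> cf cg.
apply: (@cfun_ext (fun n =>
   count (fun k => (0 < g n) && (k.+1 * g n <= f n)) (iota 0 (f n)))).
  move=> n; case: posnP => [->|g0]; first by rewrite divn0 /= count_pred0.
  rewrite (@eq_count _ _ (fun k => k < f n %/ g n)); last first.
    by move=> k /=; rewrite leq_divRL.
  have := leq_div (f n) (g n); move: (f n) (f n %/ g n) => m t tm.
  rewrite -(subnKC tm) iotaD count_cat add0n.
  rewrite (@eq_in_count _ _ predT) ?count_predT ?size_iota; last first.
    by move=> k; rewrite mem_iota => /andP[].
  rewrite (@eq_in_count _ _ pred0) ?count_pred0 ?addn0//.
  by move=> k; rewrite mem_iota => /andP[tk _]; apply/negbTE; rewrite -leqNgt.
have cpl h : cfun h -> cfun (fun e => h (pl e)).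
  by move=> ch; apply: (cfun_comp ch); exact/cfun_pl/cfun_id.
apply: cfun_count => //; apply: cpred_and.
  by apply: cpred_le; [exact: cfun_const | exact: cpl].
apply: cpred_le; last exact: cpl.
by apply: cfun_mul; [exact/cfun_S/cfun_pr/cfun_id | exact: cpl].
Qed.

Lemma cfun_mod f g : cfun f -> cfun g -> cfun (fun n => f n %% g n).
Proof.
move=> cf cg; apply: (@cfun_ext (fun n => f n - f n %/ g n * g n)).
  by move=> n; rewrite {1}(divn_eq (f n) (g n)) addKn.
by apply: cfun_sub => //; apply: cfun_mul => //; exact: cfun_div.
Qed.

Lemma cpred_odd f : cfun f -> cpred (fun n => odd (f n)).
Proof.
move=> cf; apply: (@cfun_ext (fun n => f n %% 2)); first by move=> n; rewrite modn2.
exact/cfun_mod/cfun_const.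
Qed.

End Closure.

(** A goal-directed search for programs: it peels the outermost operation. *)
Ltac program_step := cbv beta; match goal with
  | |- cfun _ (fun x => x) => exact: cfun_id
  | |- cfun _ (fun _ => ?k) => exact: cfun_const
  | |- cpred _ (fun _ => ?k) => exact: cfun_const
  | |- cfun _ pl => exact: (cfun_pl (cfun_id _))
  | |- cfun _ pr => exact: (cfun_pr (cfun_id _))
  | |- cfun _ (fun n => pl (@?f n)) => apply: (@cfun_pl _ f)
  | |- cfun _ (fun n => pr (@?f n)) => apply: (@cfun_pr _ f)
  | |- cfun _ (fun n => pairn (@?f n) (@?g n)) => apply: (@cfun_pair _ f g)
  | |- cfun _ (fun n => (@?f n).+1) => apply: (@cfun_S _ f)
  | |- cfun _ (fun n => (@?f n).-1) => apply: (@cfun_pred _ f)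
  | |- cfun _ (fun n => (@?f n) + (@?g n)) => apply: (@cfun_add _ f g)
  | |- cfun _ (fun n => (@?f n) - (@?g n)) => apply: (@cfun_sub _ f g)
  | |- cfun _ (fun n => (@?f n) * (@?g n)) => apply: (@cfun_mul _ f g)
  | |- cfun _ (fun n => (@?f n) ^ (@?g n)) => apply: (@cfun_exp _ f g)
  | |- cfun _ (fun n => (@?f n) %/ (@?g n)) => apply: (@cfun_div _ f g)
  | |- cfun _ (fun n => (@?f n) %% (@?g n)) => apply: (@cfun_mod _ f g)
  | |- cfun _ (fun n => count (@?q n) (iota 0 (@?f n))) =>
      apply: (@cfun_count _ q f)
  | |- cfun _ (fun n => find (@?q n) (iota 0 (@?f n))) =>
      apply: (@cfun_find _ q f)
  | |- cpred _ (fun n => all (@?q n) (iota 0 (@?f n))) =>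
      apply: (@cpred_all _ q f)
  | |- cpred _ (fun n => has (@?q n) (iota 0 (@?f n))) =>
      apply: (@cpred_has _ q f)
  | |- cpred _ (fun n => (@?p n) && (@?q n)) => apply: (@cpred_and _ p q)
  | |- cpred _ (fun n => (@?p n) || (@?q n)) => apply: (@cpred_or _ p q)
  | |- cpred _ (fun n => ~~ (@?p n)) => apply: (@cpred_neg _ p)
  | |- cpred _ (fun n => (@?f n) == (@?g n)) => apply: (@cpred_eq _ f g)
  | |- cpred _ (fun n => (@?f n) <= (@?g n)) => apply: (@cpred_le _ f g)
  | |- cpred _ (fun n => odd (@?f n)) => apply: (@cpred_odd _ f)
  | H : cfun _ ?F |- cfun _ (fun n => ?F (@?f n)) => apply: (cfun_comp H)
  | H : cpred _ ?F |- cpred _ (fun n => ?F (@?f n)) => apply: (cfun_comp H)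
  | H : cfun _ (fun e => ?F (pl e) (pr e))
      |- cfun _ (fun n => ?F (@?f n) (@?g n)) => apply: (cfun_uncurry2 H)
  | H : cpred _ (fun e => ?F (pl e) (pr e))
      |- cpred _ (fun n => ?F (@?f n) (@?g n)) => apply: (cpred_uncurry2 H)
  | H : cfun _ (fun e => ?F (pl (pl e)) (pr (pl e)) (pr e))
      |- cfun _ (fun n => ?F (@?f n) (@?g n) (@?h n)) => apply: (cfun_uncurry3 H)
  | H : cpred _ (fun e => ?F (pl (pl e)) (pr (pl e)) (pr e))
      |- cpred _ (fun n => ?F (@?f n) (@?g n) (@?h n)) => apply: (cpred_uncurry3 H)
  | |- _ => first [apply: cpred_if | apply: cfun_if]
  end.
Ltac program := repeat program_step.

(** * Certificates of computations *)

(** Binary digits: [D] is read as the finite set of the [m] with [bit D m], which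
    makes finite sets of numbers available to programs. *)
Definition bit (D m : nat) : bool := odd (D %/ 2 ^ m).

Lemma bit_lt D m : bit D m -> m < D.
Proof.
rewrite /bit; apply: contraLR; rewrite -leqNgt => Dm.
by rewrite divn_small// (leq_ltn_trans Dm)// ltn_expl.
Qed.

Lemma bit_exists N (p : nat -> bool) : (forall m, p m -> m < N) ->
  exists D, forall m, bit D m = p m.
Proof.
elim: N p => [|N IH] p pN.
  by exists 0 => m; rewrite /bit div0n; apply/esym/negP => /pN.
have [|D DE] := IH (fun m => p m.+1); first by move=> m /pN.
exists (p 0 + D * 2) => -[|m]; rewrite /bit.
  by rewrite expn0 divn1 oddD oddM andbF addbF oddb.
have -> : (p 0 + D * 2) %/ 2 ^ m.+1 = D %/ 2 ^ m.
  by rewrite expnS divnMA; congr (_ %/ _); case: (p 0) => /=; lia.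
exact: DE.
Qed.

Lemma cpred_bit A : cpred A (fun e => bit (pl e) (pr e)).
Proof. rewrite /bit; program. Qed.

Definition triple (e n y : nat) : nat := pairn e (pairn n y).

(** One-step justification of the claim <e, n, y> by the claims in [D].  Programs
    beyond the five basic ones have an index 4 * p + r + 5 with r < 4, where r is
    the outermost constructor and p the index, or the pair of indices, of the
    parts. *)
Definition step (D e n y : nat) : bool :=
  if e < 5 then
    if e == 0 then y == 0 else if e == 1 then y == n.+1 else
    if e == 2 then y == pl n else if e == 3 then y == pr n else y <= 1
  else
    if (e - 5) %% 4 == 0 then
      bit D (triple (pl ((e - 5) %/ 4)) n (pl y)) &&
      bit D (triple (pr ((e - 5) %/ 4)) n (pr y))
    else if (e - 5) %% 4 == 1 then
      has (fun u => bit D (triple (pr ((e - 5) %/ 4)) n u) &&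
                    bit D (triple (pl ((e - 5) %/ 4)) u y)) (iota 0 D)
    else if (e - 5) %% 4 == 2 then
      if pr n == 0 then bit D (triple (pl ((e - 5) %/ 4)) (pl n) y) else
      has (fun u => bit D (triple e (pairn (pl n) (pr n).-1) u) &&
        bit D (triple (pr ((e - 5) %/ 4)) (pairn (pl n) (pairn (pr n).-1 u)) y))
        (iota 0 D)
    else
      bit D (triple ((e - 5) %/ 4) (pairn n y) 0) &&
      all (fun i => has (fun u =>
        bit D (triple ((e - 5) %/ 4) (pairn n i) u.+1)) (iota 0 D)) (iota 0 y).

Definition valid (D : nat) : bool :=
  all (fun t => ~~ bit D t || step D (pl t) (pl (pr t)) (pr (pr t))) (iota 0 D).

Lemma cpred_valid A : cpred A valid.
Proof.
rewrite /valid /step /triple; have B := cpred_bit A; program.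
Qed.

(** The same as [step], but on programs and for an arbitrary set of claims. *)
Definition justified (S : nat -> nat -> nat -> Prop) (c : code) (n y : nat) :
    Prop :=
  match c with
  | Zero => y = 0
  | Succ => y = n.+1
  | Left => y = pl n
  | Right => y = pr n
  | Oracle => y <= 1
  | Pair f g => S (code_index f) n (pl y) /\ S (code_index g) n (pr y)
  | Comp f g => exists u, S (code_index g) n u /\ S (code_index f) u y
  | Prec f g =>
      if pr n is k.+1 then
        exists u, S (code_index c) (pairn (pl n) k) u /\
                  S (code_index g) (pairn (pl n) (pairn k u)) y
      else S (code_index f) (pl n) y
  | Rfind f =>
      S (code_index f) (pairn n y) 0 /\
      forall i, i < y -> exists u, S (code_index f) (pairn n i) u.+1
  end.

Lemma has_iotaP (p : nat -> bool) N :
  reflect (exists2 i, i < N & p i) (has p (iota 0 N)).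
Proof.
by apply: (iffP hasP) => -[i iN pi]; exists i => //; move: iN; rewrite mem_iota.
Qed.

Lemma all_iotaP (p : nat -> bool) N :
  reflect (forall i, i < N -> p i) (all p (iota 0 N)).
Proof.
by apply: (iffP allP) => pN i => [iN|]; [apply: pN | rewrite mem_iota /= => /pN];
  rewrite ?mem_iota.
Qed.

(** How [step] decodes the index of a compound program. *)
Lemma code_index_ge5 c : match c with
  | Zero | Succ | Left | Right | Oracle => True
  | Pair f g => [/\ 5 <= code_index c, (code_index c - 5) %% 4 = 0
      & (code_index c - 5) %/ 4 = pairn (code_index f) (code_index g)]
  | Comp f g => [/\ 5 <= code_index c, (code_index c - 5) %% 4 = 1
      & (code_index c - 5) %/ 4 = pairn (code_index f) (code_index g)]
  | Prec f g => [/\ 5 <= code_index c, (code_index c - 5) %% 4 = 2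
      & (code_index c - 5) %/ 4 = pairn (code_index f) (code_index g)]
  | Rfind f => [/\ 5 <= code_index c, (code_index c - 5) %% 4 = 3
      & (code_index c - 5) %/ 4 = code_index f]
  end.
Proof. by case: c => //= *; split; lia. Qed.

Lemma triple_lt D e n y : bit D (triple e n y) -> y < D.
Proof.
move=> /bit_lt; apply: leq_ltn_trans; rewrite /triple.
by have [_ h1] := leq_pairn n y; have [_ h2] := leq_pairn e (pairn n y); lia.
Qed.

Lemma stepP D c n y :
  step D (code_index c) n y <->
  justified (fun e n y => bit D (triple e n y)) c n y.
Proof.
case: c => [||||| f g | f g | f g | f] /=; rewrite /step.
- by split => [/eqP|/eqP].
- by split => [/eqP|/eqP].
- by split => [/eqP|/eqP].
- by split => [/eqP|/eqP].
- by [].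
- have [/= e5 e4 ep] := code_index_ge5 (Pair f g).
  rewrite ltnNge e5 /= e4 ep plE prE /=.
  by split => [/andP|[Df Dg]] //; apply/andP.
- have [/= e5 e4 ep] := code_index_ge5 (Comp f g).
  rewrite ltnNge e5 /= e4 ep plE prE /=.
  split => [/has_iotaP[u _ /andP[]]|[u [gu fu]]]; first by exists u.
  by apply/has_iotaP; exists u; [exact: triple_lt gu | rewrite gu].
- have [/= e5 e4 ep] := code_index_ge5 (Prec f g).
  rewrite ltnNge e5 /= e4 ep plE prE /=; case: (pr n) => [|k] //=.
  split => [/has_iotaP[u _ /andP[]]|[u [gu fu]]]; first by exists u.
  by apply/has_iotaP; exists u; [exact: triple_lt gu | rewrite gu].
- have [/= e5 e4 ep] := code_index_ge5 (Rfind f).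
  rewrite ltnNge e5 /= e4 ep /=; split.
    move=> /andP[f0 /all_iotaP fS]; split => // i /fS.
    by move=> /has_iotaP [u _ fu]; exists u.
  move=> [f0 fS]; apply/andP; split=> //; apply/all_iotaP => i /fS [u fu].
  by apply/has_iotaP; exists u => //; exact/ltnW/(triple_lt fu).
Qed.

Lemma justified_mono (S S' : nat -> nat -> nat -> Prop) c n y :
  (forall e n y, S e n y -> S' e n y) -> justified S c n y -> justified S' c n y.
Proof.
move=> SS'; case: c => [||||| f g | f g | f g | f] //=.
- by move=> [? ?]; split; exact: SS'.
- by move=> [u [? ?]]; exists u; split; exact: SS'.
- case: (pr n) => [|k]; first exact: SS'.
  by move=> [u [? ?]]; exists u; split; exact: SS'.
- move=> [? fS]; split; first exact: SS'.
  by move=> i /fS [u ?]; exists u; exact: SS'.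
Qed.

(** A valid set need not be ordered: justifications go to smaller programs, or to
    an earlier step of the same recursion, so they are well founded. *)
Lemma valid_sound A D c n y : valid D ->
  (forall n y, bit D (triple 4 n y) -> eval A Oracle n y) ->
  bit D (triple (code_index c) n y) -> eval A c n y.
Proof.
move=> /all_iotaP vD oD.
have {}vD c' n' y' : bit D (triple (code_index c') n' y') ->
    justified (fun e n y => bit D (triple e n y)) c' n' y'.
  move=> Dc; apply/stepP; have := vD _ (bit_lt Dc).
  by rewrite Dc /triple !(plE, prE).
elim: c n y => [||||| f IHf g IHg | f IHf g IHg | f IHf g IHg | f IHf] n y Dc.
- exact: (vD _ _ _ Dc).
- exact: (vD _ _ _ Dc).
- exact: (vD _ _ _ Dc).
- exact: (vD _ _ _ Dc).
- exact: oD.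
- have [fu gu] := vD _ _ _ Dc; exists (pl y), (pr y).
  by split; [exact: IHf | exact: IHg | rewrite pairnK].
- by have [u [gu fu]] := vD _ _ _ Dc; exists u; [exact: IHg | exact: IHf].
- move: Dc; rewrite -(pairnK n); elim: (pr n) y => [|k IHk] y Dc.
    by apply/eval_Prec0; have /= := vD _ _ _ Dc; rewrite plE prE => /IHf.
  apply/eval_PrecS; have /= := vD _ _ _ Dc; rewrite plE prE => -[u [/IHk ? /IHg ?]].
  by exists u.
- have [f0 fS] := vD _ _ _ Dc; split; first exact: IHf.
  by move=> i /fS [u /IHf fu]; exists u.
Qed.

(** Claims that are true as well as justified, so that the answers of the oracle
    in a certificate are correct. *)
Definition certificate A (s : seq nat) : Prop :=
  forall t, t \in s -> exists c n y, [/\ t = triple (code_index c) n y,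
    justified (fun e n y => triple e n y \in s) c n y & eval A c n y].

Lemma certificate_cat A s t :
  certificate A s -> certificate A t -> certificate A (s ++ t).
Proof.
move=> cs ct u; rewrite mem_cat => /orP[/cs|/ct] [c [n [y [-> jc ec]]]];
  exists c, n, y; split => //; apply: justified_mono jc => e n' y';
  by rewrite mem_cat => ->; rewrite ?orbT.
Qed.

Lemma certificate_cons A s c n y : certificate A s -> eval A c n y ->
  justified (fun e n y => triple e n y \in s) c n y ->
  certificate A (triple (code_index c) n y :: s).
Proof.
move=> cs ec jc u; have sub e n' y' : triple e n' y' \in s ->
    triple e n' y' \in triple (code_index c) n y :: s.
  by rewrite inE => ->; rewrite orbT.
rewrite inE => /orP[/eqP->|/cs [c' [n' [y' [-> jc' ec']]]]].
  by exists c, n, y; split => //; exact: justified_mono jc.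
by exists c', n', y'; split => //; exact: justified_mono jc'.
Qed.

Lemma certificate_exists A c n y : eval A c n y ->
  exists2 s, certificate A s & triple (code_index c) n y \in s.
Proof.
have top s c' n' y' : certificate A s -> eval A c' n' y' ->
    justified (fun e n y => triple e n y \in s) c' n' y' ->
    exists2 s, certificate A s & triple (code_index c') n' y' \in s.
  move=> cs ec jc; exists (triple (code_index c') n' y' :: s).
    exact: certificate_cons.
  by rewrite inE eqxx.
have c0 : certificate A [::] by [].
elim: c n y => [||||| f IHf g IHg | f IHf g IHg | f IHf g IHg | f IHf] n y ec.
- exact: (top [::]).
- exact: (top [::]).
- exact: (top [::]).
- exact: (top [::]).
- by apply: (top [::]) => //=; move: ec => /= [[_ ->]|[_ ->]].
- have [u [v [fu gv yE]]] := ec.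
  have [s cs us] := IHf _ _ fu; have [t ct vt] := IHg _ _ gv.
  apply: (top (s ++ t)) => //=; first exact: certificate_cat.
  by rewrite yE plE prE !mem_cat us vt orbT.
- have [u gu fy] := ec.
  have [s cs us] := IHg _ _ gu; have [t ct vt] := IHf _ _ fy.
  apply: (top (s ++ t)) => //=; first exact: certificate_cat.
  by exists u; rewrite !mem_cat us vt orbT.
- move: ec; rewrite -(pairnK n); elim: (pr n) y => [|k IHk] y ec.
    have /eval_Prec0 fy := ec; have [s cs us] := IHf _ _ fy.
    by apply: (top s) => //=; rewrite plE prE.
  have /eval_PrecS [u gu fy] := ec.
  have [s cs us] := IHk _ gu; have [t ct vt] := IHg _ _ fy.
  apply: (top (s ++ t)) => //; first exact: certificate_cat.
  by rewrite /justified plE prE; exists u; rewrite !mem_cat us vt orbT.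
- have [f0 fS] := ec; have [s cs us] := IHf _ _ f0.
  have [t ct vt] : exists2 t, certificate A t &
      forall i, i < y -> exists u, triple (code_index f) (pairn n i) u.+1 \in t.
    elim: y fS {ec f0 s cs us} => [|k IHk] fS; first by exists [::].
    have [i ik|t ct vt] := IHk; first exact/fS/ltnW.
    have [v fv] := fS k (ltnSn k); have [s cs us] := IHf _ _ fv.
    exists (s ++ t); first exact: certificate_cat.
    move=> i; rewrite ltnS leq_eqVlt => /orP[/eqP->|/vt [u ut]].
      by exists v; rewrite mem_cat us.
    by exists u; rewrite mem_cat ut orbT.
  apply: (top (s ++ t)) => //=; first exact: certificate_cat.
  split; first by rewrite mem_cat us.
  by move=> i /vt [u ut]; exists u; rewrite mem_cat ut orbT.
Qed.

(** The normal form of computations: all that depends on the oracle is the truth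
    of the claims about the program [Oracle], whose index is 4. *)
Lemma evalP A c n y :
  eval A c n y <-> exists D, [/\ valid D, bit D (triple (code_index c) n y)
    & forall n y, bit D (triple 4 n y) -> eval A Oracle n y].
Proof.
split=> [/certificate_exists [s cs us]|[D [vD Dc oD]]]; last exact: valid_sound oD Dc.
have [|D DE] := @bit_exists (\max_(t <- s) t).+1 (fun t => t \in s).
  by move=> m ms; rewrite ltnS; exact: (@leq_bigmax_seq _ s xpredT id m).
exists D; rewrite DE; split => //.
  apply/all_iotaP => t _; rewrite DE; have [ts /=|//] := boolP (t \in s).
  have [c' [n' [y' [-> jc _]]]] := cs _ ts.
  rewrite /triple !(plE, prE); apply/stepP; apply: justified_mono jc => e i j.
  by rewrite DE.
move=> m z; rewrite DE => /cs [c' [n' [y' [tE _ ec]]]].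
have [E [-> ->]] : 4 = code_index c' /\ m = n' /\ z = y'.
  by have [-> /pairn_inj [-> ->]] := pairn_inj tE.
by case: c' E {tE} ec => //= *; lia.
Qed.

(** * Sets that are c.e. in the halting problem *)

Lemma code_index_surj e : exists c, code_index c = e.
Proof.
elim/ltn_ind: e => e IH; have [e5|e5] := ltnP e 5.
  have : code_index (nth Oracle [:: Zero; Succ; Left; Right] e) = e.
    by move: e5; case: e {IH} => [|[|[|[|[|e]]]]].
  by exists (nth Oracle [:: Zero; Succ; Left; Right] e).
have [lel ler] := leq_pairn (pl ((e - 5) %/ 4)) (pr ((e - 5) %/ 4)).
rewrite pairnK in lel ler.
have [|f fE] := IH (pl ((e - 5) %/ 4)); first lia.
have [|g gE] := IH (pr ((e - 5) %/ 4)); first lia.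
have [|h hE] := IH ((e - 5) %/ 4); first lia.
have : (e - 5) %% 4 < 4 by rewrite ltn_mod.
case E : ((e - 5) %% 4) => [|[|[|[|//]]]] _.
- by exists (Pair f g); rewrite /= fE gE pairnK; lia.
- by exists (Comp f g); rewrite /= fE gE pairnK; lia.
- by exists (Prec f g); rewrite /= fE gE pairnK; lia.
- by exists (Rfind h); rewrite /= hE; lia.
Qed.

Lemma code_index_inj : injective code_index.
Proof.
elim=> [||||| f IHf g IHg | f IHf g IHg | f IHf g IHg | f IHf];
  case=> [||||| f' g' | f' g' | f' g' | f'] //= E; try lia.
- have /pairn_inj [/IHf -> /IHg ->] :
    pairn (code_index f) (code_index g) = pairn (code_index f') (code_index g')
    by lia.
  by [].
- have /pairn_inj [/IHf -> /IHg ->] :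
    pairn (code_index f) (code_index g) = pairn (code_index f') (code_index g')
    by lia.
  by [].
- have /pairn_inj [/IHf -> /IHg ->] :
    pairn (code_index f) (code_index g) = pairn (code_index f') (code_index g')
    by lia.
  by [].
- by congr Rfind; apply: IHf; lia.
Qed.

Lemma jump_code_index A c : jump A (code_index c) <-> halts A c (code_index c).
Proof. by split=> [[d /code_index_inj ->]|cc]; last exists c. Qed.

(** With the empty oracle, correct answers of the oracle are all 0. *)
Definition jump_stage (e D : nat) : bool :=
  [&& valid D,
      all (fun t => ~~ (bit D t && (pl t == 4)) || (pr (pr t) == 0)) (iota 0 D) &
      has (fun y => bit D (triple e e y)) (iota 0 D)].

Lemma cpred_jump_stage A : cpred A (fun e => jump_stage (pl e) (pr e)).
Proof.
have B := cpred_bit A; have V := cpred_valid A.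
by rewrite /jump_stage /triple; program.
Qed.

Lemma zero_jumpP e : zero_jump e <-> exists D, jump_stage e D.
Proof.
have [c <-] := code_index_surj e; rewrite /zero_jump jump_code_index.
split=> [[y /evalP [D [vD Dc oD]]]|[D /and3P [vD /all_iotaP oD /has_iotaP [y _ Dc]]]].
  exists D; apply/and3P; split => //.
    apply/all_iotaP => t _; apply/orP.
    have [/andP[Dt /eqP t4]|] := boolP (bit D t && (pl t == 4)); last by left.
    right; have : bit D (triple 4 (pl (pr t)) (pr (pr t))).
      by rewrite /triple pairnK -t4 pairnK.
    by move=> /oD /= [[]//|[_ ->]].
  by apply/has_iotaP; exists y => //; exact: triple_lt Dc.
exists y; apply: valid_sound vD _ Dc => m z Dm.
have := oD _ (bit_lt Dm); rewrite Dm /triple !(plE, prE) eqxx /= => /eqP ->.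
by right; split => // -[].
Qed.

Definition sigma2 (W : set nat) : Prop :=
  exists2 R : nat -> nat -> nat -> bool,
    cpred set0 (fun e => R (pl (pl e)) (pr (pl e)) (pr e)) &
    forall n, W n <-> exists w, forall v, R n w v.

Fixpoint const_code (k : nat) : code :=
  if k is k'.+1 then Comp Succ (const_code k') else Zero.

Lemma eval_const_code A k n : eval A (const_code k) n k.
Proof. by elim: k => [|k IHk] //=; exists k. Qed.

Lemma cfun_const_code A : cfun A (fun k => code_index (const_code k)).
Proof.
apply: (@cfun_ext _ (fun k => nat_rect (fun=> nat) 0
   (fun _ r => 4 * pairn 1 r + 6) k)); first by elim=> [|k /= ->].
by apply: cfun_rec; program.
Qed.

(** The program [search <n, w>] looks for a v that refutes R n w v, so the halting
    problem tells whether w is a witness for n; searching for w with this oracle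
    enumerates W.  The program ignores its input, so it halts on its own index
    iff it halts at all. *)
Lemma sigma2_ce W : sigma2 W -> ce_in zero_jump W.
Proof.
move=> [R cR WR]; have [c ec] := cpred_neg (cpred_neg cR).
pose search m := Comp (Rfind c) (const_code m).
have search_halts m : halts set0 (search m) (code_index (search m)) <->
    exists v, ~~ R (pl m) (pr m) v.
  split.
    move=> [y [_ /= /(eval_fun (eval_const_code set0 m _)) <- [cy _]]].
    exists y; have := eval_fun cy (ec (pairn m y)); rewrite !(plE, prE).
    by case: (R _ _ _).
  move=> vR; case: (ex_minnP vR) => v Rv vmin; exists v, m.
    exact: eval_const_code.
  split=> [|i iv].
    by have := ec (pairn m v); rewrite !(plE, prE) (negbTE Rv).
  exists 0; have := ec (pairn m i); rewrite !(plE, prE).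
  by case: (boolP (R (pl m) (pr m) i)) => // /vmin; rewrite leqNgt iv.
have [d ed] : cfun zero_jump (fun m => code_index (search m)).
  by rewrite /search /=; have C := cfun_const_code zero_jump; program.
have dE n y : zero_jump (code_index (search (pairn n y))) <->
    ~ forall v, R n y v.
  rewrite /zero_jump jump_code_index search_halts plE prE.
  by split => [[v /negP nR] /(_ v)|/existsNP [v /negP]] //; exists v.
exists (Rfind (Comp Oracle d)); apply/seteqP; split => n /=.
  move=> /WR Wn.
  have {}Wn : exists w, `[< forall v, R n w v >].
    by have [w Rw] := Wn; exists w; exact/asboolP.
  case: (ex_minnP Wn) => w /asboolP Rw wmin; exists w; split.
    by exists (code_index (search (pairn n w))) => //; right; split => // /dE; apply.
  move=> i iw; exists 0, (code_index (search (pairn n i))) => //.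
  left; split=> //; apply/dE => Ri.
  by have := wmin i (asboolT Ri); rewrite leqNgt iw.
move=> [y [[m em [[_ //]|[nm _]]] _]]; apply/WR; exists y => v.
have mE := eval_fun em (ed (pairn n y)); rewrite {}mE in nm.
by apply: contrapT => nR; apply: nm; apply/dE => /(_ v).
Qed.

Lemma bounded_collection (Q : nat -> nat -> Prop) N :
  (forall t, t < N -> exists x, Q t x) ->
  exists T, forall t, t < N -> exists2 x, x < T & Q t x.
Proof.
elim: N => [|N IHN] QN; first by exists 0.
have [t tN|T QT] := IHN; first exact/QN/ltnW.
have [x Qx] := QN N (ltnSn N); exists (maxn T x.+1) => t.
rewrite ltnS leq_eqVlt => /orP[/eqP->|/QT [y yT Qy]].
  by exists x; rewrite // leq_max ltnSn orbT.
by exists y; rewrite // leq_max yT.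
Qed.

(** The witness consists of a certificate D and a bound T for the stages that
    confirm the positive answers of the oracle in D. *)
Lemma ce_sigma2 W : ce_in zero_jump W -> sigma2 W.
Proof.
move=> [c ->].
exists (fun n w v => [&& valid (pl w),
  has (fun y => bit (pl w) (triple (code_index c) n y)) (iota 0 (pl w)) &
  all (fun t => ~~ (bit (pl w) t && (pl t == 4)) ||
     ((pr (pr t) == 1) && has (jump_stage (pl (pr t))) (iota 0 (pr w))) ||
     ((pr (pr t) == 0) && ~~ jump_stage (pl (pr t)) v)) (iota 0 (pl w))]).
  have B := cpred_bit set0; have V := cpred_valid set0.
  have J := cpred_jump_stage set0; rewrite /triple; program.
move=> n; split.
  move=> [y /evalP [D [vD Dc oD]]].
  have oD' t : bit D t -> pl t = 4 -> eval zero_jump Oracle (pl (pr t)) (pr (pr t)).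
    by move=> Dt t4; apply: oD; rewrite /triple pairnK -t4 pairnK.
  have [|T TE] := @bounded_collection (fun t x => bit D t -> pl t = 4 ->
      pr (pr t) = 1 -> jump_stage (pl (pr t)) x) D.
    move=> t _; have [[Dt [t4 t1]]|nt] := pselect (bit D t /\ pl t = 4 /\ pr (pr t) = 1).
      by have [[/zero_jumpP [x xt] _]|[_ t0]] := oD' t Dt t4;
        [exists x | move: t0; rewrite t1].
    by exists 0 => *; case: nt.
  exists (pairn D T) => v; rewrite plE prE vD /=; apply/andP; split.
    by apply/has_iotaP; exists y => //; exact: triple_lt Dc.
  apply/all_iotaP => t tD; rewrite -orbA; apply/orP.
  have [/andP[Dt /eqP t4]|] := boolP (bit D t && (pl t == 4)); last by left.
  right; apply/orP; have [[_ t1]|[nt t0]] := oD' t Dt t4.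
    left; rewrite t1 eqxx; apply/has_iotaP.
    by have [x xT tx] := TE t tD; exists x => //; exact: tx.
  right; rewrite t0 eqxx /=; apply/negP => tv.
  by apply: nt; apply/zero_jumpP; exists v.
move=> [w wE]; have /and3P [vD /has_iotaP [y _ Dy] _] := wE 0.
exists y; apply: valid_sound vD _ Dy => m z Dm.
have Dz v : (z == 1) && has (jump_stage m) (iota 0 (pr w)) ||
    (z == 0) && ~~ jump_stage m v.
  have /and3P [_ _ /all_iotaP] := wE v => /(_ _ (bit_lt Dm)).
  by rewrite Dm /triple !(plE, prE) eqxx.
have /orP [/andP[/eqP -> /has_iotaP[x _ mx]]|/andP[/eqP z0 _]] := Dz 0.
  by left; split => //; apply/zero_jumpP; exists x.
right; split => // /zero_jumpP [v mv].
by have := Dz v; rewrite z0 mv.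
Qed.

(** * Prefixes, dyadic rationals and binary expansions *)

Fixpoint prefix_val (X : nat -> bool) (K : nat) : nat :=
  if K is k.+1 then 2 * prefix_val X k + X k else 0.

(** The code [strn] of the first [k] among the [K] binary digits of [j], the most
    significant digit coming first. *)
Definition prefix_code (K k j : nat) : nat :=
  \sum_(i < k) (bit j (K - i.+1)).+1 * 2 ^ i.

Lemma cfun_prefix_code A :
  cfun A (fun e => prefix_code (pl (pl e)) (pr (pl e)) (pr e)).
Proof.
have B := cpred_bit A; rewrite /prefix_code.
apply: (@cfun_sum _ (fun e i => (bit (pr e) (pl (pl e) - i.+1)).+1 * 2 ^ i)
                    (fun e => pr (pl e))); program.
Qed.

Lemma prefix_val_lt X K : prefix_val X K < 2 ^ K.
Proof.
by elim: K => [|K IHK] //=; rewrite expnS; case: (X K) => /=; lia.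
Qed.

Lemma bit0 D : bit D 0 = odd D.
Proof. by rewrite /bit expn0 divn1. Qed.

Lemma bitS D (b : bool) m : bit (2 * D + b) m.+1 = bit D m.
Proof.
rewrite /bit expnS divnMA; congr (odd (_ %/ _)).
by case: b; lia.
Qed.

Lemma bit_prefix_val X K i : i < K -> bit (prefix_val X K) (K - i.+1) = X i.
Proof.
elim: K => [|K IHK] //; rewrite ltnS leq_eqVlt => /orP[/eqP->|iK] /=.
  by rewrite subnn bit0 oddD oddM /= oddb.
by rewrite subSS -(subnSK iK) bitS IHK.
Qed.

(** The cylinder of a longer prefix is contained in that of a shorter one. *)
Lemma prefix_val_shift X K m :
  2 ^ m * prefix_val X K <= prefix_val X (K + m) /\
  prefix_val X (K + m) < 2 ^ m * (prefix_val X K).+1.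
Proof.
elim: m => [|m [IH1 IH2]]; first by rewrite addn0 expn0 !mul1n.
rewrite addnS /= expnS -!mulnA; case: (X (K + m)) => /=; lia.
Qed.

Lemma eq_prefix_val X Y K :
  (forall i, i < K -> X i = Y i) -> prefix_val X K = prefix_val Y K.
Proof.
elim: K => [|K IHK] //= XY; rewrite XY// IHK// => i iK.
exact/XY/ltnW.
Qed.

Lemma prefix_val_surj K j : j < 2 ^ K -> exists X, prefix_val X K = j.
Proof.
elim: K j => [|K IHK] j; first by rewrite expn0; case: j => // _; exists xpredT.
rewrite expnS => jK; have [|X XE] := IHK (j %/ 2); first lia.
exists (fun i => if i == K then odd j else X i) => /=; rewrite eqxx.
rewrite (@eq_prefix_val _ X) => [|i iK]; last by rewrite ltn_eqF.
by rewrite XE -modn2; lia.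
Qed.

Lemma strn_mkseq X k : strn (mkseq X k) = \sum_(i < k) (X i).+1 * 2 ^ i.
Proof.
elim: k X => [|k IHk] X; first by rewrite big_ord0.
have -> : mkseq X k.+1 = X 0 :: mkseq (fun i => X i.+1) k.
  by rewrite /mkseq /= (iotaDl 1 0 k) -map_comp.
rewrite big_ord_recl expn0 muln1 /= IHk.
have -> : \sum_(i < k) (X (bump 0 i)).+1 * 2 ^ bump 0 i =
    2 * \sum_(i < k) (X i.+1).+1 * 2 ^ i.
  rewrite big_distrr /=; apply: eq_bigr => i _.
  by rewrite /bump leq0n add1n expnS mulnCA.
lia.
Qed.

Lemma prefix_code_val X K k : k <= K ->
  prefix_code K k (prefix_val X K) = strn (mkseq X k).
Proof.
move=> kK; rewrite strn_mkseq; apply: eq_bigr => i _.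
by rewrite bit_prefix_val// (leq_trans (ltn_ord i)).
Qed.

Lemma strn_inj : injective strn.
Proof.
elim=> [|b s IHs] [|c t] //= E; [lia | lia |].
have [-> /IHs ->] : b = c /\ strn s = strn t.
  by move: E; case: b; case: c => /= E; split => //; lia.
by [].
Qed.

Lemma prefix_code_inj X K j k : j < 2 ^ K ->
  prefix_code K K j = strn (mkseq X k) -> k = K /\ j = prefix_val X K.
Proof.
move=> /prefix_val_surj [Y <-]; rewrite prefix_code_val// => /strn_inj E.
have kK : k = K by have := congr1 size E; rewrite !size_mkseq.
split=> //; apply: eq_prefix_val => i iK.
by have := congr1 (nth true ^~ i) E; rewrite !nth_mkseq ?kK.
Qed.

Local Open Scope ring_scope.

Section Binval.
Variable R : realType.
Implicit Types (X : nat -> bool) (y : R).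

Definition dyadic (j K : nat) : R := j%:R / 2 ^+ K.

Lemma le_dyadic i j K : (dyadic i K <= dyadic j K) = (i <= j)%N.
Proof. by rewrite ler_pM2r ?invr_gt0 ?exprn_gt0// ler_nat. Qed.

Lemma lt_dyadic i j K : (dyadic i K < dyadic j K) = (i < j)%N.
Proof. by rewrite ltr_pM2r ?invr_gt0 ?exprn_gt0// ltr_nat. Qed.

Lemma dyadic_shift j K m : dyadic j K = dyadic (2 ^ m * j) (K + m).
Proof.
rewrite /dyadic natrM natrX exprD [2 ^+ K * _]mulrC -mulf_div.
by rewrite divff ?mul1r// expf_neq0.
Qed.

Lemma dyadicS j K : dyadic j.+1 K = dyadic j K + 2 ^- K.
Proof. by rewrite /dyadic -addn1 natrD mulrDl mul1r. Qed.

Lemma near_dyadic_small (e : R) : 0 < e -> \forall K \near \oo, 2 ^- K < e.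
Proof.
move=> e0; near=> K; rewrite invf_plt ?posrE ?exprn_gt0//.
have : (Num.truncn e^-1).+1%:R <= K%:R :> R.
  by rewrite ler_nat; near: K; exact: nbhs_infty_ge.
have eK := truncnS_gt e^-1.
move=> h; apply: lt_le_trans eK (le_trans h _).
by rewrite -natrX ler_nat ltnW// ltn_expl.
Unshelve. all: by end_near. Qed.

Lemma series_binval X K :
  series (fun i => (X i)%:R / 2 ^+ i.+1 : R) K = dyadic (prefix_val X K) K.
Proof.
rewrite /series /=; elim: K => [|K IHK]; first by rewrite big_geq// /dyadic mul0r.
rewrite big_nat_recr//= IHK (dyadic_shift _ _ 1) addn1 expn1.
by rewrite /dyadic -mulrDl -natrD.
Qed.

Lemma dyadic_prefix_ge X K m :
  dyadic (prefix_val X K) K <= dyadic (prefix_val X (K + m)) (K + m).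
Proof.
by rewrite (dyadic_shift _ _ m) le_dyadic; case: (prefix_val_shift X K m).
Qed.

Lemma dyadic_prefix_le X K m :
  dyadic (prefix_val X (K + m)) (K + m) <= dyadic (prefix_val X K).+1 K.
Proof.
rewrite (dyadic_shift _ K m) le_dyadic.
by case: (prefix_val_shift X K m) => _ /ltnW.
Qed.

Lemma cvg_binval X : dyadic (prefix_val X K) K @[K --> \oo] --> binval R X.
Proof.
have -> : (fun K => dyadic (prefix_val X K) K) =
    series (fun i => (X i)%:R / 2 ^+ i.+1 : R).
  by apply/funext => K; rewrite series_binval.
apply: (nondecreasing_is_cvgn (R := R)).
  by move=> K L KL; rewrite !series_binval -(subnKC KL) dyadic_prefix_ge.
exists (dyadic 1 0) => _ [K _ <-]; rewrite series_binval.
exact: (dyadic_prefix_le X 0 K).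
Qed.

Lemma binval_itv X K :
  dyadic (prefix_val X K) K <= binval R X <= dyadic (prefix_val X K).+1 K.
Proof.
apply/andP; split.
  rewrite -(cvg_lim _ (@cvg_binval X))//; apply: limr_ge; first exact: cvgP (@cvg_binval X).
  by exists K => // L /= KL; rewrite -(subnKC KL) dyadic_prefix_ge.
rewrite -(cvg_lim _ (@cvg_binval X))//; apply: limr_le; first exact: cvgP (@cvg_binval X).
by exists K => // L /= KL; rewrite -(subnKC KL) dyadic_prefix_le.
Qed.

Lemma binval_unique X y :
  (forall K, dyadic (prefix_val X K) K <= y <= dyadic (prefix_val X K).+1 K) ->
  binval R X = y.
Proof.
move=> yX; apply/eqP/negPn/negP; rewrite -subr_eq0 -normr_gt0 => /near_dyadic_small.
move=> [K _ /(_ K (leqnn K))] /=; apply/negP; rewrite -leNgt ler_distl.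
have := yX K; have := binval_itv X K; rewrite dyadicS => /andP[? ?] /andP[? ?].
by apply/andP; split; lra.
Qed.

(** The digits are the parities of the integer parts of y * 2 ^ i.  The right end
    of each dyadic interval is excluded, so that a real determines its
    dyadic intervals. *)
Lemma binval_digits y : 0 <= y ->
  y < 1 -> exists X, forall K,
    dyadic (prefix_val X K) K <= y < dyadic (prefix_val X K).+1 K.
Proof.
move=> y0 y1; pose t K := Num.truncn (y * 2 ^+ K).
have tE K : (t K)%:R <= y * 2 ^+ K < (t K).+1%:R.
  by apply: truncn_itv; rewrite mulr_ge0.
exists (fun i => odd (t i.+1)) => K.
have -> : prefix_val (fun i => odd (t i.+1)) K = t K.
  elim: K => [|K /= ->].
    by apply/esym/truncn0Pn; rewrite expr0 mulr1 -ltNge.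
  have /andP[h1 h2] := tE K; have /andP[] := tE K.+1.
  rewrite exprS [y * _]mulrCA => h3 h4.
  have : (2 * t K < (t K.+1).+1)%N.
    by rewrite -(ltr_nat R) natrM; apply: le_lt_trans h4; rewrite ler_pM2l.
  have : (t K.+1 < 2 * (t K).+1)%N.
    by rewrite -(ltr_nat R) natrM; apply: le_lt_trans h3 _; rewrite ltr_pM2l.
  by rewrite -modn2; lia.
have := tE K; rewrite /dyadic ler_pdivrMr ?exprn_gt0// ltr_pdivlMr ?exprn_gt0//.
Qed.

End Binval.

(** * Kurtz random reals pass all tests *)

Definition ratn_le (x y : nat) : bool :=
  (pl (pl x) * (pr y).+1 + pr (pl y) * (pr x).+1 <=
   pl (pl y) * (pr x).+1 + pr (pl x) * (pr y).+1)%N.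

Lemma ratn_leE x y : ratn_le x y = (ratn x <= ratn y).
Proof.
rewrite /ratn -!/(pl _) -!/(pr _) -!/(pl (pl _)) -!/(pr (pl _)).
rewrite ler_pdivrMr ?ltr0Sn// mulrAC ler_pdivlMr ?ltr0Sn//.
by rewrite !mulrBl lerBlDr addrAC lerBrDr -!natrM -!natrD ler_nat.
Qed.

Lemma cpred_ratn_le A : cpred A (fun e => ratn_le (pl e) (pr e)).
Proof. rewrite /ratn_le; program. Qed.

Definition dyadic_code (j K : nat) : nat := pairn (pairn j 0) (2 ^ K).-1.

Lemma cfun_dyadic_code A : cfun A (fun e => dyadic_code (pl e) (pr e)).
Proof. rewrite /dyadic_code; program. Qed.

Lemma ratn_dyadic_code (R : realType) j K :
  ratr (ratn (dyadic_code j K)) = dyadic R j K.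
Proof.
rewrite /ratn /dyadic_code -!/(pl _) -!/(pr _) !(plE, prE) subr0.
by rewrite fmorph_div !rmorph_nat prednK ?expn_gt0// natrX.
Qed.

Section Measure.
Variable R : realType.
Local Notation mu := (@lebesgue_measure R).

(** This is monotonicity of the outer measure from
    which Lebesgue measure is built. *)
Lemma le_lebesgue_measure (A B : set R) : A `<=` B -> (mu A <= mu B)%E.
Proof. exact: (@le_outer_measure _ _ ((wlength (@idfun R))^*)%mu A B). Qed.

Lemma lebesgue_measure_eq0 (A : set R) :
  (forall n, (mu A <= (2 ^- n)%:E)%E) -> mu A = 0%E.
Proof.
move=> An; have A0 : (0 <= mu A)%E by exact: measure_ge0.
have : (mu A < +oo)%E by apply: le_lt_trans (An 0%N) _; rewrite ltry.
case: (mu A) A0 An => // r; rewrite lee_fin => r0 An _; congr EFin.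
apply/eqP; rewrite eq_le r0 andbT leNgt; apply/negP => /near_dyadic_small.
move=> [n _ /(_ n (leqnn n))] /=; apply/negP; rewrite -leNgt.
by have := An n; rewrite lee_fin.
Qed.

End Measure.

Lemma finite_set_ltn (A : set nat) : finite_set A ->
  exists N, forall i, (N <= i)%N -> ~ A i.
Proof.
move=> /finite_seqP [s ->]; exists (\max_(i <- s) i).+1 => i si /= /[dup] is_.
by move=> /(@leq_bigmax_seq _ s xpredT id i)/(_ isT); rewrite leqNgt si.
Qed.

Section KurtzTest.
Variables (R : realType) (a b : nat -> nat -> R).
Hypothesis ab : finitely_left_ce_test a b.

(** Almost all intervals of a level are [0, 0]. *)
Lemma test_level0 n : test_level a b n 0.
Proof.
have [_ _ abn /(_ n) /finite_set_ltn [N bN] _] := ab.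
exists N => //=; rewrite in_itv /=; have [a0 _ _] := abn n N.
have b0 : b n N = 0 by apply: contrapT => /eqP /(bN N (leqnn N)).
by have [a0' ab' _] := abn n N; rewrite b0 lexx andbT -b0.
Qed.

(** A level is a finite union of closed intervals together with 0, so a small
    cylinder around a point outside of it keeps a distance from each of them.
    The bound below the cylinder is the left neighbour of its left end, at a
    positive distance from it. *)
Lemma cylinder_separated n (X : nat -> bool) : ~ test_level a b n (binval R X) ->
  exists N K, [/\ (0 < prefix_val X K)%N,
    forall i, (N <= i)%N -> b n i = 0 &
    forall i, (i < N)%N -> b n i <= dyadic R (prefix_val X K).-1 K \/
                      dyadic R (prefix_val X K).+1 K < a n i].
Proof.
set y := binval R X => ny.
have [_ _ abn /(_ n) /finite_set_ltn [N bN] _] := ab.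
have y0 : 0 < y.
  rewrite lt_neqAle; apply/andP; split.
    by apply: contra_notN ny => /eqP <-; exact: test_level0.
  by have /andP[+ _] := binval_itv R X 0; apply: le_trans; rewrite /dyadic mul0r.
have pos : \forall K \near \oo, (0 < prefix_val X K)%N.
  near=> K; rewrite lt0n; apply/negP => /eqP p0.
  have /andP[_] := binval_itv R X K; rewrite p0 /dyadic mul1r leNgt => /negP; apply.
  by near: K; exact: near_dyadic_small.
have sep : \forall K \near \oo, forall i : 'I_N,
    b n i <= dyadic R (prefix_val X K).-1 K \/
    dyadic R (prefix_val X K).+1 K < a n i.
  apply: filter_forall => i.
  have [bi|yb] := ltP (b n i) y.
    have e0 : 0 < (y - b n i) / 2 by rewrite divr_gt0// subr_gt0.
    near=> K; left.
    have p0 : (0 < prefix_val X K)%N by near: K.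
    have := binval_itv R X K; rewrite -/y => /andP[_].
    rewrite -{1}(prednK p0) !dyadicS.
    have : 2 ^- K < (y - b n i) / 2 by near: K; exact: near_dyadic_small.
    lra.
  have [ya|ay] := ltP y (a n i); last first.
    by exfalso; apply: ny; exists i => //=; rewrite in_itv /= ay yb.
  have e0 : 0 < a n i - y by rewrite subr_gt0.
  near=> K; right.
  have := binval_itv R X K; rewrite -/y dyadicS => /andP[+ _].
  have : 2 ^- K < a n i - y by near: K; exact: near_dyadic_small.
  lra.
have [K _ /(_ K (leqnn K)) [p0 sepK]] := filterI pos sep.
exists N, K; split => // i Ni; last exact: (sepK (Ordinal Ni)).
by apply: contrapT => /eqP; exact: bN.
Unshelve. all: by end_near. Qed.

Variables fa fb : nat -> nat.
Let qa n i s := ratn (fa (pairn n (pairn i s))).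
Let qb n i s := ratn (fb (pairn n (pairn i s))).
Hypothesis fa_cfun : computable fa.
Hypothesis fb_cfun : computable fb.
Hypothesis qa_mono : forall n i s, qa n i s <= qa n i s.+1.
Hypothesis qb_mono : forall n i s, qb n i s <= qb n i s.+1.
Hypothesis qa_cvg : forall n i, (ratr (qa n i s) : R) @[s --> \oo] --> a n i.
Hypothesis qb_cvg : forall n i, (ratr (qb n i s) : R) @[s --> \oo] --> b n i.

Let qle (q : nat -> nat -> nat -> rat) (c : nat -> nat -> R) n i s :
  (forall s, q n i s <= q n i s.+1) -> (ratr (q n i s) : R) @[s --> \oo] --> c n i ->
  ratr (q n i s) <= c n i.
Proof.
move=> qmono qcvg; rewrite -(cvg_lim _ qcvg)//.
apply: (nondecreasing_cvgn_le (u_ := fun s => ratr (q n i s))).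
  by apply/nondecreasing_seqP => {}s; rewrite ler_rat.
exact: cvgP qcvg.
Qed.

(** The cylinder coded by m misses level n.  Here w = <<n, N>, <t, <K, j>>>, where
    the cylinder is [j / 2^K, (j + 1) / 2^K], and v = <i, s>, where s is a stage
    of the approximation of b_i. *)
Let sep (m w v : nat) : bool :=
  let n := pl (pl w) in let N := pr (pl w) in let t := pl (pr w) in
  let K := pl (pr (pr w)) in let j := pr (pr (pr w)) in
  [&& m == prefix_code K K j, (j < 2 ^ K)%N, (0 < j)%N &
    ratn_le (fb (pairn n v)) (dyadic_code j.-1 K) ||
    ((pl v < N)%N &&
     ~~ ratn_le (fa (pairn n (pairn (pl v) t))) (dyadic_code j.+1 K))].

Let W : set nat := [set m | exists w, forall v, sep m w v].

Let ceW : ce_in zero_jump W.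
Proof.
apply: sigma2_ce; exists sep => //; rewrite /sep.
have Hle := cpred_ratn_le set0; have Hd := cfun_dyadic_code set0.
have Hp := cfun_prefix_code set0; have Ha : cfun set0 fa := fa_cfun.
have Hb : cfun set0 fb := fb_cfun.
program.
Qed.

Let W_separates X k : W (strn (mkseq X k)) ->
  exists n, ~ test_level a b n (binval R X).
Proof.
move=> [w]; rewrite /sep; set n := pl (pl w); set N := pr _; set t := pl (pr w).
set K := pl _; set j := pr _ => wE; exists n => -[i _] /=.
have /and4P [/eqP mE jK j0 _] := wE 0%N.
have [kK jE] := prefix_code_inj jK (esym mE).
have := binval_itv R X K; rewrite -jE => /andP[y1 y2].
rewrite in_itv /= => /andP[ay yb].
have [qu|qu] := ltP (dyadic R j.+1 K) (ratr (qa n i t)).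
  have := @qle qa a n i t (@qa_mono n i) (@qa_cvg n i).
  by rewrite leNgt (le_lt_trans ay)// (le_lt_trans y2).
have : b n i <= dyadic R j.-1 K.
  rewrite -(cvg_lim _ (@qb_cvg n i))//; apply: limr_le.
    exact: cvgP (@qb_cvg n i).
  apply: nearW => s; have /and4P [_ _ _] := wE (pairn i s).
  rewrite plE !ratn_leE => /orP[|/andP[_]].
    by rewrite -(ler_rat R) ratn_dyadic_code.
  by rewrite -(ler_rat R) ratn_dyadic_code qu.
rewrite leNgt => /negP; apply; apply: lt_le_trans yb; apply: lt_le_trans y1.
by rewrite lt_dyadic prednK.
Qed.

Let separated_W n X : ~ test_level a b n (binval R X) ->
  exists k, W (strn (mkseq X k)).
Proof.
move=> /cylinder_separated [N [K [j0 bN sepK]]].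
have [t tE] : exists t, forall i : 'I_N,
    dyadic R (prefix_val X K).+1 K < a n i ->
    dyadic R (prefix_val X K).+1 K < ratr (qa n i t).
  have : \forall t \near \oo, forall i : 'I_N,
      dyadic R (prefix_val X K).+1 K < a n i ->
      dyadic R (prefix_val X K).+1 K < ratr (qa n i t).
    apply: filter_forall => i; have [ua|ua] := pselect (dyadic R (prefix_val X K).+1 K < a n i).
      by apply: filterS (cvgr_gt _ (@qa_cvg n i) _ ua) => t ut _.
    by apply: nearW => t /ua.
  by move=> [t _ /(_ t (leqnn t))] ?; exists t.
exists K, (pairn (pairn n N) (pairn t (pairn K (prefix_val X K)))) => v.
rewrite /sep !(plE, prE) prefix_code_val// eqxx prefix_val_lt j0 /=.
rewrite !ratn_leE -!(ler_rat R) !ratn_dyadic_code -ltNge.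
have vb : ratr (qb n (pl v) (pr v)) <= b n (pl v).
  exact: (@qle qb b n (pl v) (pr v) (@qb_mono n _) (@qb_cvg n _)).
rewrite /qb pairnK in vb.
have [vN|Nv] := ltnP (pl v) N.
  have [bu|ua] := sepK _ vN; first by rewrite (le_trans vb bu).
  by rewrite (tE (Ordinal vN) ua) orbT.
by rewrite (le_trans vb)// bN// divr_ge0.
Qed.

Lemma test_null_class : exists P : set (nat -> bool), [/\ Pi01_class zero_jump P,
  lebesgue_measure (@binval R @` P) = 0%E &
  forall X, (\bigcap_n test_level a b n) (binval R X) -> P X].
Proof.
exists [set X | forall k, ~ W (strn (mkseq X k))]; split; first by exists W.
  apply: lebesgue_measure_eq0 => n; have [_ _ _ _ mn] := ab.
  apply: le_trans (mn n); apply: le_lebesgue_measure => _ [X XP <-].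
  by apply: contrapT => /separated_W [k /XP].
by move=> X Xab k /W_separates [n]; apply; exact: Xab.
Qed.

End KurtzTest.

Lemma Kurtz_finitely_left_ce (R : realType) (x : nat -> bool) :
  Kurtz_random R zero_jump x -> finitely_left_ce_random (binval R x).
Proof.
move=> Kx a b ab xab; have [[fa fac faE] [fb fbc fbE] _ _ _] := ab.
have [||||P [PP P0 /(_ _ xab)]] := test_null_class ab fac fbc; last exact: Kx.
- by move=> n i s; exact: (faE n i).1.
- by move=> n i s; exact: (fbE n i).1.
- by move=> n i; exact: (faE n i).2.
- by move=> n i; exact: (fbE n i).2.
Qed.

(** * Reals that pass all tests are Kurtz random *)

Lemma nondecreasing_nat_stable (u : nat -> nat) B :
  (forall s, u s <= u s.+1)%N -> (forall s, u s <= B)%N ->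
  \forall s \near \oo, forall s', (s <= s')%N -> u s' = u s.
Proof.
move=> /(homo_leq leqnn leq_trans) umono uB.
have ex : exists m, `[< exists s, u s = m >] by exists (u 0%N); apply/asboolP; exists 0%N.
have ub m : `[< exists s, u s = m >] -> (m <= B)%N by move=> /asboolP [s <-].
case: (ex_maxnP ex ub) => _ /asboolP [s0 <-] umax.
have top s : (s0 <= s)%N -> u s = u s0.
  move=> ss; apply/eqP; rewrite eqn_leq [X in _ && X]umono// andbT; apply: umax.
  by apply/asboolP; exists s.
by exists s0 => // s /= ss s' ss'; rewrite !top// (leq_trans ss).
Qed.

Lemma sumr_count (R : realType) (p : nat -> bool) (r : R) N :
  \sum_(j < N) (if p j then r else 0) = (count p (iota 0 N))%:R * r.
Proof.
elim: N => [|N IHN]; first by rewrite big_ord0 mul0r.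
rewrite iota_rcons count_cat big_ord_recr /= IHN addn0 natrD mulrDl.
by case: (p N); rewrite ?mul1r ?mul0r.
Qed.

Lemma prefix_code_half K k j (b : bool) : (k <= K)%N ->
  prefix_code K.+1 k (2 * j + b) = prefix_code K k j.
Proof.
move=> kK; apply: eq_bigr => i _.
by rewrite subSS -(subnSK (leq_trans (ltn_ord i) kK)) bitS.
Qed.

Section Survivors.
Variable Q : nat -> nat -> nat -> bool.

(** Strings m with some z such that Q m z v for all v are those that a class
    excludes.  The cylinder of depth [K] and index [j] survives stage [s] when
    each z <= K is refuted before s as a reason to exclude one of its
    prefixes. *)
Definition survives (s K j : nat) : bool :=
  all (fun k => all (fun z =>
    has (fun v => ~~ Q (prefix_code K k j) z v) (iota 0 s)) (iota 0 K.+1))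
    (iota 0 K.+1).

Definition survivors (s K : nat) : nat := count (survives s K) (iota 0 (2 ^ K)).

(** The least depth with at most 2 ^ (K - n) survivors at stage [s]; it is [s]
    when no depth below [s] has this property. *)
Definition guess (n s : nat) : nat :=
  find (fun K => survivors s K * 2 ^ n <= 2 ^ K)%N (iota 0 s).

(** Stage [s] of the left ([d = 0]) or right ([d = 1]) end of the interval of
    level [n] with index i = <K, j>, which is reserved for the cylinder of depth K
    and index j. *)
Definition endpoint (d n i s : nat) : nat :=
  if (pr i < 2 ^ pl i)%N then
    if (pl i < guess n s)%N then dyadic_code 1 0
    else if (pl i == guess n s) && survives s (pl i) (pr i)
         then dyadic_code (pr i + d) (pl i) else dyadic_code 0 0
  else dyadic_code 0 0.

Lemma cfun_endpoint d : cpred set0 (fun e => Q (pl (pl e)) (pr (pl e)) (pr e)) ->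
  cfun set0 (fun e => endpoint d (pl e) (pl (pr e)) (pr (pr e))).
Proof.
move=> cQ; have Hp := cfun_prefix_code set0.
have Hs : cpred set0 (fun e => survives (pl (pl e)) (pr (pl e)) (pr e)).
  by rewrite /survives; program.
have Hn : cfun set0 (fun e => survivors (pl e) (pr e)).
  by rewrite /survivors; program.
have Hg : cfun set0 (fun e => guess (pl e) (pr e)) by rewrite /guess; program.
by have Hd := cfun_dyadic_code set0; rewrite /endpoint; program.
Qed.

Lemma survivesP s K j : reflect (forall k z, (k <= K)%N -> (z <= K)%N ->
    exists2 v, (v < s)%N & ~~ Q (prefix_code K k j) z v) (survives s K j).
Proof.
apply: (iffP (all_iotaP _ _)) => H k.
  by move=> z kK zK; have /all_iotaP /(_ z zK) /has_iotaP := H k kK.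
by move=> kK; apply/all_iotaP => z zK; apply/has_iotaP; exact: H.
Qed.

Lemma survives_mono s s' K j : (s <= s')%N -> survives s K j -> survives s' K j.
Proof.
move=> ss /survivesP sK; apply/survivesP => k z kK zK.
by have [v vs Qv] := sK k z kK zK; exists v => //; exact: leq_trans ss.
Qed.

Lemma survivors_mono s s' K : (s <= s')%N -> (survivors s K <= survivors s' K)%N.
Proof. by move=> ss; apply: sub_count => j; exact: survives_mono. Qed.

(** The survivors increase with the stage, so a depth once rejected remains
    rejected. *)
Lemma guess_mono n s : (guess n s <= guess n s.+1)%N.
Proof.
rewrite leqNgt; apply/negP => lt.
have gs : (guess n s <= s)%N by rewrite -[leqRHS](size_iota 0) find_size.
have g's := leq_trans lt gs.
have := before_find 0%N lt; rewrite nth_iota// add0n.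
have /(nth_find 0%N) : has (fun K => survivors s.+1 K * 2 ^ n <= 2 ^ K)%N (iota 0 s.+1).
  by rewrite has_find size_iota ltnW.
rewrite -/(guess n s.+1) (nth_iota _ _ (leqW g's)) add0n => le.
by rewrite (leq_trans _ le)// leq_mul2r survivors_mono ?orbT.
Qed.

Lemma guess_le n s K : (forall s, survivors s K * 2 ^ n <= 2 ^ K)%N ->
  (guess n s <= K)%N.
Proof.
move=> gK; rewrite leqNgt; apply/negP => lt.
have gs : (guess n s <= s)%N by rewrite -[leqRHS](size_iota 0) find_size.
have := before_find 0%N lt; rewrite nth_iota ?add0n ?gK//.
exact: leq_trans gs.
Qed.

Lemma guess_good n s : (guess n s < s)%N ->
  (survivors s (guess n s) * 2 ^ n <= 2 ^ guess n s)%N.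
Proof.
move=> gs; have /(nth_find 0%N) : has (fun K => survivors s K * 2 ^ n <= 2 ^ K)%N (iota 0 s).
  by rewrite has_find size_iota.
by rewrite -/(guess n s) nth_iota.
Qed.

(** The guess and the survivors at the guessed depth settle simultaneously. *)
Lemma guess_stable n K : (forall s, survivors s K * 2 ^ n <= 2 ^ K)%N ->
  exists s, (guess n s < s)%N /\ forall s', (s <= s')%N ->
    guess n s' = guess n s /\
    forall j, (j < 2 ^ guess n s)%N ->
      survives s' (guess n s) j = survives s (guess n s) j.
Proof.
move=> gK.
have [s1 _ g1] := nondecreasing_nat_stable (guess_mono n) (fun s => @guess_le n s K gK).
have : \forall s \near \oo, forall j : 'I_(2 ^ guess n s1), forall s', (s <= s')%N ->
    nat_of_bool (survives s' (guess n s1) j) = survives s (guess n s1) j.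
  apply: filter_forall => j; apply: (@nondecreasing_nat_stable _ 1%N) => s.
    have := @survives_mono s s.+1 (guess n s1) j (leqnSn s).
    by case: (survives s _ _) => // ->.
  exact: leq_b1.
move=> [s2 _ g2]; pose s := maxn s1 (maxn s2 K.+1); exists s.
have s1s : (s1 <= s)%N by rewrite leq_max leqnn.
have s2s : (s2 <= s)%N by rewrite !leq_max leqnn orbT.
have gs : guess n s = guess n s1 by exact: (g1 s1 (leqnn s1)).
split; first by rewrite (leq_ltn_trans (guess_le s gK))// !leq_max leqnn !orbT.
move=> s' ss'; rewrite gs; split; first by apply: (g1 s1 (leqnn s1)); exact: leq_trans ss'.
move=> j jK; have := g2 s s2s (Ordinal jK) s' ss' => /=.
by case: (survives s' _ _); case: (survives s _ _).
Qed.

(** The Pi01 class whose excluded strings are given by Q. *)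
Definition closed_class : set (nat -> bool) :=
  [set X | forall k z, exists v, ~~ Q (strn (mkseq X k)) z v].

(** Membership requires only finitely many refutations per depth, so
    some stage has found all of them. *)
Lemma closed_class_survives X : closed_class X <->
  forall K, exists s, survives s K (prefix_val X K).
Proof.
split=> [PX K|sX k z]; last first.
  have [s /survivesP /(_ k z (leq_maxl k z) (leq_maxr k z))] := sX (maxn k z).
  by rewrite prefix_code_val ?leq_maxl// => -[v _ Qv]; exists v.
have [|S HS] := @bounded_collection (fun k T => forall z, (z < K.+1)%N ->
    exists2 v, (v < T)%N & ~~ Q (strn (mkseq X k)) z v) K.+1.
  move=> k _; apply: bounded_collection => z _; exact: PX.
exists S; apply/survivesP => k z kK zK; rewrite prefix_code_val//.
have [T TS /(_ z zK) [v vT Qv]] := HS k kK.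
by exists v => //; exact: ltn_trans TS.
Qed.

Section Measure.
Variable R : realType.
Local Notation mu := (@lebesgue_measure R).

Let live K j : bool := `[< exists s, survives s K j >].

(** Half-open cells are disjoint, hence the measure of their union is their number
    times 2^-K, and a point in all the unions has a single cell at each
    depth. *)
Let cell K j : set R :=
  if live K j then `[dyadic R j K, dyadic R j.+1 K[%classic else set0.

Let live_cells K : set R := \big[setU/set0]_(j < 2 ^ K) cell K j.

Let live_cellsP K y : live_cells K y <-> exists X, live K (prefix_val X K) /\
  forall L, dyadic R (prefix_val X L) L <= y < dyadic R (prefix_val X L).+1 L.
Proof.
rewrite /live_cells -bigcup_mkord; split.
  move=> [j /= jK]; rewrite /cell; case: ifP => // lj; rewrite /= in_itv /= => /andP[y1 y2].
  have [||X Xy] := @binval_digits R y.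
  - by apply: le_trans y1; rewrite divr_ge0.
  - apply: (lt_le_trans y2); rewrite ler_pdivrMr ?exprn_gt0// mul1r -natrX.
    by rewrite ler_nat.
  exists X; split => //; suff -> : prefix_val X K = j by [].
  have /andP[y3 y4] := Xy K.
  have := le_lt_trans y1 y4; have := le_lt_trans y3 y2.
  by rewrite !lt_dyadic; lia.
move=> [X [lX /(_ K) yX]]; exists (prefix_val X K); first exact: prefix_val_lt.
by rewrite /cell lX /= in_itv.
Qed.

Let live_cells_closed : \bigcap_K live_cells K `<=` @binval R @` closed_class.
Proof.
move=> y yE; have /live_cellsP [X [_ Xy]] := yE 0%N I.
exists X; last first.
  by apply: binval_unique => K; have /andP[-> /ltW ->] := Xy K.
apply/closed_class_survives => K; have /live_cellsP [Y [lY Yy]] := yE K I.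
suff -> : prefix_val X K = prefix_val Y K by apply/asboolP.
have /andP[x1 x2] := Xy K; have /andP[y1 y2] := Yy K.
have := le_lt_trans x1 y2; have := le_lt_trans y1 x2.
by rewrite !lt_dyadic; lia.
Qed.

Let live_cells_mono : nonincreasing_seq live_cells.
Proof.
apply/nonincreasing_seqP => K; apply/subsetPset => y /live_cellsP [X [/asboolP [s sX] Xy]].
apply/live_cellsP; exists X; split => //; apply/asboolP; exists s.
apply/survivesP => k z kK zK; move/survivesP : sX => /(_ k z (leqW kK) (leqW zK)).
by rewrite /= prefix_code_half.
Qed.

Let measurable_cell K j : measurable (cell K j).
Proof. by rewrite /cell; case: ifP => _; [exact: measurable_itv|]. Qed.

Let measurable_live_cells K : measurable (live_cells K).
Proof. by apply: bigsetU_measurable => j _; exact: measurable_cell. Qed.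

Let lebesgue_live_cells K :
  mu (live_cells K) = ((count (live K) (iota 0 (2 ^ K)))%:R * 2 ^- K)%:E.
Proof.
have disjoint : trivIset setT (cell K).
  apply/trivIsetP => i j _ _ /eqP ij; rewrite /cell.
  case: ifP => _; last by rewrite set0I.
  case: ifP => _; last by rewrite setI0.
  apply/seteqP; split => // y [] /=; rewrite !in_itv /= => /andP[i1 i2] /andP[j1 j2].
  have := le_lt_trans i1 j2; have := le_lt_trans j1 i2.
  by rewrite !lt_dyadic; lia.
rewrite -sumr_count /live_cells -sumEFin (measure_bigsetU mu)//; last first.
  by move=> j; exact: measurable_cell.
apply: eq_bigr => j _; rewrite /cell; case: ifP => _; last exact: measure0.
rewrite [LHS]lebesgue_measure_itv /= lte_fin lt_dyadic leqnn -EFinB.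
by rewrite dyadicS addrAC subrr add0r.
Qed.

(** The unions of live cells decrease to a set of reals of members of the class,
    so their measures tend to 0 by continuity from above. *)
Lemma null_few_survivors n : mu (@binval R @` closed_class) = 0%E ->
  exists K, forall s, (survivors s K * 2 ^ n <= 2 ^ K)%N.
Proof.
move=> P0; apply: contrapT => /forallNP few.
have big K : (2 ^ K < count (live K) (iota 0 (2 ^ K)) * 2 ^ n)%N.
  have /existsNP [s /negP] := few K; rewrite -ltnNge => /leq_trans; apply.
  by rewrite leq_mul2r sub_count ?orbT// => j sj; apply/asboolP; exists s.
have cap0 : mu (\bigcap_K live_cells K) = 0%E.
  by apply/eqP; rewrite eq_le measure_ge0 andbT -P0 le_lebesgue_measure.
have cv : mu \o live_cells @ \oo --> mu (\bigcap_K live_cells K).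
  apply: (nonincreasing_cvg_mu (mu := mu)) => //.
    by rewrite [X in (X < _)%E]lebesgue_live_cells ltry.
  by apply: bigcap_measurable => // K _; exact: measurable_live_cells.
rewrite cap0 in cv.
have /fine_cvgP [_ /cvgr_lt /(_ (2 ^- n))] := cv.
rewrite invr_gt0 exprn_gt0// => /(_ isT) [K _ /(_ K (leqnn K))] /=.
rewrite lebesgue_live_cells /= ltr_pdivrMr ?exprn_gt0// mulrC ltr_pdivlMr ?exprn_gt0//.
by rewrite -!natrX -natrM ltr_nat ltnNge ltnW.
Qed.

Hypothesis cQ : cpred set0 (fun e => Q (pl (pl e)) (pr (pl e)) (pr e)).
Hypothesis Q0 : mu (@binval R @` closed_class) = 0%E.

Let value d n i s : R := ratr (ratn (endpoint d n i s)).

Let valueE d n i s : value d n i s =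
  if (pr i < 2 ^ pl i)%N then
    if (pl i < guess n s)%N then 1
    else if (pl i == guess n s) && survives s (pl i) (pr i)
         then dyadic R (pr i + d) (pl i) else 0
  else 0.
Proof.
rewrite /value /endpoint.
have d0 : dyadic R 0 0 = 0 by rewrite /dyadic mul0r.
have d1 : dyadic R 1 0 = 1 by rewrite /dyadic expr0 divr1.
case: ifP => _; last by rewrite ratn_dyadic_code.
by do 2 (case: ifP => _; rewrite ?ratn_dyadic_code//).
Qed.

Let dyadic_ge0 j K : 0 <= dyadic R j K.
Proof. by rewrite divr_ge0. Qed.

Let dyadic_le1 j K : (j <= 2 ^ K)%N -> dyadic R j K <= 1.
Proof. by move=> jK; rewrite ler_pdivrMr ?exprn_gt0// mul1r -natrX ler_nat. Qed.

(** The values 0, then j / 2^K or (j + 1) / 2^K, then 1 appear in this order. *)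
Let value_mono d n i s : (d <= 1)%N -> value d n i s <= value d n i s.+1.
Proof.
move=> d1; rewrite !valueE; case: ifP => // jK; have gm := guess_mono n s.
have dl : dyadic R (pr i + d) (pl i) <= 1 by apply: dyadic_le1; lia.
have [lt|_] := ltnP (pl i) (guess n s); first by rewrite (leq_trans lt).
have [lt|ge] := ltnP (pl i) (guess n s.+1).
  by case: ifP => // _.
case: ifP => [/andP[/eqP E sv]|_]; last by case: ifP.
have -> : pl i == guess n s.+1 by lia.
by rewrite (survives_mono (leqnSn s) sv).
Qed.

(** A stage after which no endpoint of level [n] moves. *)
Let stage n : nat := projT1 (cid (guess_stable
  (projT2 (cid (@null_few_survivors n Q0))))).

Let stageP n : (guess n (stage n) < stage n)%N /\ forall s', (stage n <= s')%N ->
    guess n s' = guess n (stage n) /\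
    forall j, (j < 2 ^ guess n (stage n))%N ->
      survives s' (guess n (stage n)) j = survives (stage n) (guess n (stage n)) j.
Proof. by rewrite /stage; case: cid. Qed.

Let bound d n i : R := value d n i (stage n).

Let value_cvg d n i : value d n i s @[s --> \oo] --> bound d n i.
Proof.
apply: cvg_near_cst; exists (stage n) => // s /= /(stageP n).2 [gs sv].
rewrite /bound !valueE gs; case: ifP => // jK; case: ifP => // _.
by case: eqP => //= E; rewrite E sv// -E.
Qed.

Let uniformly_left_ce_bound d : (d <= 1)%N -> uniformly_left_ce (bound d).
Proof.
move=> d1; exists (fun e => endpoint d (pl e) (pl (pr e)) (pr (pr e))).
  exact: cfun_endpoint.
move=> n i; split => [s|].
  by rewrite !(plE, prE) -(ler_rat R); exact: value_mono.
by under eq_fun do rewrite !(plE, prE); exact: value_cvg.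
Qed.

Let bound_itv n i : [/\ 0 <= bound 0 n i, bound 0 n i <= bound 1 n i & bound 1 n i <= 1].
Proof.
rewrite /bound !valueE; case: ifP => // jK; case: ifP => // _; case: ifP => // _.
by rewrite addn0 addn1 dyadic_ge0 le_dyadic leqnSn dyadic_le1.
Qed.

Let finite_bound n : finite_set [set i | bound 1 n i != 0].
Proof.
set K := guess n (stage n).
apply: (@sub_finite_set _ _ ((fun p => pairn p.1 p.2) @` (`I_K.+1 `*` `I_(2 ^ K)))).
  move=> i /=; rewrite /bound valueE; case: ifP => [jK|_ /eqP//].
  have iK : (pl i <= K)%N -> (`I_K.+1 `*` `I_(2 ^ K)) (pl i, pr i).
    move=> iK; split => //=; apply: leq_trans jK _.
    by rewrite leq_exp2l.
  case: ifP => [/ltnW /iK h _|_]; first by exists (pl i, pr i) => //; exact: pairnK.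
  case: ifP => [/andP[/eqP E _] _|_ /eqP//].
  by exists (pl i, pr i); [apply: iK; rewrite E | exact: pairnK].
by apply: finite_image; apply: finite_setX; exact: finite_II.
Qed.

(** The intervals that have been given up contribute only 1, those not yet reached
    only 0, and the others are the survivors at the final guess. *)
Let lebesgue_test n : (mu (test_level (bound 0) (bound 1) n) <= (2 ^- n)%:E)%E.
Proof.
have [/guess_good + _] := stageP n; set K := guess n (stage n); set s := stage n => gK.
pose B j : set R := if survives s K j then `[dyadic R j K, dyadic R j.+1 K]%classic
                    else set0.
have mB j : measurable (B j).
  by rewrite /B; case: ifP => _ //; exact: measurable_itv.
have sub : test_level (bound 0) (bound 1) n `<=`
    [set 0] `|` [set 1] `|` \big[setU/set0]_(j < 2 ^ K) B j.
  move=> y [i _] /=; rewrite /bound !valueE in_itv /=; case: ifP => jK; last first.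
    by move=> h; left; left; apply/eqP; rewrite eq_le andbC.
  case: ifP => _.
    by move=> h; left; right; apply/eqP; rewrite eq_le andbC.
  case: ifP => [/andP[/eqP E sv]|_]; last first.
    by move=> h; left; left; apply/eqP; rewrite eq_le andbC.
  rewrite addn0 addn1 => h; right; rewrite -bigcup_mkord; exists (pr i) => /=.
    by rewrite /K -E.
  by rewrite /B /K -E sv /= in_itv.
apply: le_trans (le_lebesgue_measure sub) _.
apply: le_trans (measureU2 _ _ _) _.
- exact: measurableU.
- by apply: bigsetU_measurable => j _; exact: mB.
rewrite [X in (X + _)%E](_ : _ = 0%E) ?add0e; last first.
  apply/eqP; rewrite eq_le measure_ge0 andbT.
  apply: le_trans (measureU2 _ _ _) _ => //.
  rewrite [X in (X + _)%E]lebesgue_measure_set1.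
  by rewrite [X in (_ + X)%E]lebesgue_measure_set1 adde0.
apply: le_trans.
  by apply: Boole_inequality => j _; exact: mB.
rewrite (eq_bigr (fun j : 'I__ => (if survives s K j then 2 ^- K else 0 : R)%:E)).
  rewrite sumEFin sumr_count lee_fin ler_pdivrMr ?exprn_gt0//.
  rewrite mulrC ler_pdivlMr ?exprn_gt0//.
  by rewrite -!natrX -natrM ler_nat.
move=> j _; rewrite /B; case: ifP => _; last exact: measure0.
rewrite [LHS]lebesgue_measure_itv /= lte_fin lt_dyadic leqnn -EFinB.
by rewrite dyadicS addrAC subrr add0r.
Qed.

Lemma null_class_covered : exists a b, finitely_left_ce_test a b /\
  forall X, closed_class X -> (\bigcap_n test_level a b n) (binval R X).
Proof.
exists (bound 0), (bound 1); split.
  split; [exact: uniformly_left_ce_bound | exact: uniformly_left_ce_bound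
  | exact: bound_itv | exact: finite_bound | exact: lebesgue_test].
move=> X PX n _; set K := guess n (stage n).
exists (pairn K (prefix_val X K)) => //=.
have sv : survives (stage n) K (prefix_val X K).
  have [s sX] := (closed_class_survives X).1 PX K.
  have [_ stable] := (stageP n).2 (maxn s (stage n)) (leq_maxr _ _).
  rewrite -(stable _ (prefix_val_lt X K)).
  exact: survives_mono (leq_maxl _ _) sX.
rewrite in_itv /bound !valueE !(plE, prE) prefix_val_lt ltnn eqxx sv /=.
by rewrite addn0 addn1 binval_itv.
Qed.

End Measure.
End Survivors.

Lemma finitely_left_ce_Kurtz (R : realType) (x : nat -> bool) :
  finitely_left_ce_random (binval R x) -> Kurtz_random R zero_jump x.
Proof.
move=> rx P [W /ce_sigma2 [Q cQ WQ] PE] P0 Px.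
have PQ : P = closed_class Q.
  rewrite PE; apply/seteqP; split => X /= PX k.
    move=> z; apply: contrapT => /forallNP Qz; apply: (PX k); apply/WQ; exists z => v.
    exact/negPn/negP/Qz.
  by move=> /WQ [z zv]; have [v] := PX k z; rewrite zv.
rewrite PQ in P0 Px.
have [a [b [ab cov]]] := null_class_covered cQ P0.
exact: rx ab (cov _ Px).
Qed.

Theorem proposition5p18 (R : realType) (x : nat -> bool) :
  Kurtz_random R zero_jump x <-> finitely_left_ce_random (binval R x).
Proof.
split; [exact: Kurtz_finitely_left_ce | exact: finitely_left_ce_Kurtz].
Qed.
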